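(* Let $n\ge 2$ be a prime power, and let $GK$ be the Giulietti--Korchmáros curve over $\mathbb{F}_{n^6}$, with point at infinity $P_\infty$ and points $P_1,\dots,P_n$, where $P_j=(a_j,0,0)$ and $a_1,\dots,a_n$ are the distinct roots of $X^n+X=0$. Put $a=n^2-n+1$, $b=n^3$, $c=n^3+1$. For $1\le m\le n$, let $\Gamma_{m+1}$ be the set of all tuples $$\Bigl(\bigl(n^2-m-\sum_{s=1}^m j_s\bigr)c-ina-kb,\; j_1c+ia+k,\;\ldots,\; j_mc+ia+k\Bigr)$$ where $k,i,j_1,\dots,j_m$ are integers with $1\le k\le a$, $0\le i\le n$, $j_s\ge 0$ for all $s$, and $\bigl(n^2-m-\sum_{s=1}^m j_s\bigr)c-ina-kb>0$. Then $$\Gamma(P_\infty,P_1,\ldots,P_m)=\Gamma_{m+1},$$ where $\Gamma(P_\infty,P_1,\ldots,P_m)$ is the minimal generating set of the Weierstrass semigroup $H(P_\infty,P_1,\ldots,P_m)$.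
   Context: The $GK$ curve. Let $n\ge2$ be a prime power and $q=n^3$. $GK$ is the nonsingular, absolutely irreducible projective curve in $\mathbb{P}^3$ over $\mathbb{F}_{q^2}=\mathbb{F}_{n^6}$ with affine equations $Z^{n^2-n+1}=Y\,h(X)$, $X^n+X=Y^{n+1}$, where $h(X)=\sum_{i=0}^{n}(-1)^{i+1}X^{i(n-1)}$. It has a single point at infinity $P_\infty=(1:0:0:0)$ and genus $g=\frac12(n^3+1)(n^2-2)+1$. Its function field is $\mathbb{F}_{q^2}(x,y,z)$ with $z^{n^2-n+1}=y\,h(x)$ and $x^n+x=y^{n+1}$. For $j=1,\dots,n$, $P_j=(a_j,0,0)$ with $a_j^n+a_j=0$ (all $n$ such points, which are $\mathbb{F}_{q^2}$-rational). Weierstrass semigroup. For distinct rational points $R_1,\dots,R_r$ on a curve $\mathcal{X}$ over a finite field $F$, $H(R_1,\dots,R_r)=\{(u_1,\dots,u_r)\in\mathbb{N}_0^r : \exists f\in F(\mathcal{X}) \text{ with pole divisor } (f)_\infty=\sum_i u_iR_i\}$, where $\mathbb{N}_0=\mathbb{N}\cup\{0\}$ and $\mathbb{N}$ is the set of positive integers. Minimal generating set. On $\mathbb{N}_0^r$ let $\preceq$ be the componentwise partial order. For $\mathbf{u}=(u_1,\dots,u_r)\in\mathbb{N}_0^r$ and $1\le i\le r$, put $\nabla_i(\mathbf{u})=\{(p_1,\dots,p_r)\in H(R_1,\dots,R_r): p_i=u_i\}$. For $r\ge2$, $\Gamma(R_1,\dots,R_r)=\{\mathbf{u}\in\mathbb{N}^r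 : \mathbf{u}\text{ is minimal with respect to }\preceq\text{ in }\nabla_i(\mathbf{u})\text{ for some }i,\ 1\le i\le r\}$ (in particular $\mathbf{u}\in H(R_1,\dots,R_r)$). *)

(* Defs.v *)
From HB Require Import structures.
From mathcomp Require Import all_boot all_order all_algebra.
From mathcomp Require Import boolp classical_sets.

Set Implicit Arguments.
Unset Strict Implicit.
Unset Printing Implicit Defensive.

Import Order.TTheory GRing.Theory Num.Theory.

Local Open Scope classical_set_scope.
Local Open Scope ring_scope.

Definition prime_power (n : nat) : Prop :=
  exists p e : nat, [/\ prime p, (0 < e)%N & n = (p ^ e)%N].

(** A place of the function field K over the field of constants F (embedded by
    iota), given by its normalized discrete valuation.  The value at 0, usually
    +oo, is the junk value 0, so that a place is determined by its valuation on
    the nonzero elements. *)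
Record place (F K : fieldType) (iota : {rmorphism F -> K}) := Place {
  pval :> K -> int;
  pval0 : pval 0 = 0;
  pvalM : forall f g, f != 0 -> g != 0 -> pval (f * g) = pval f + pval g;
  pvalD : forall f g, f != 0 -> g != 0 -> f + g != 0 ->
    Num.min (pval f) (pval g) <= pval (f + g);
  pvalC : forall k : F, k != 0 -> pval (iota k) = 0;
  pval_surj : exists t, pval t = 1
}.

Section FunctionField.
Variables (F K : fieldType) (iota : {rmorphism F -> K}).

Definition pole_order (f : K) (Q : place iota) : nat :=
  absz (Num.max (0 : int) (- Q f)).

(** (f)_oo = \sum_i u_i R_i, compared coefficientwise at every place Q. *)
Definition has_pole_divisor r (R : 'I_r -> place iota) (f : K)
    (u : 'I_r -> nat) : Prop :=
  forall Q : place iota,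
    pole_order f Q = (\sum_(i < r | `[< R i = Q >]) u i)%N.

Definition Wsemigroup r (R : 'I_r -> place iota) : set ('I_r -> nat) :=
  [set u | exists f : K, f != 0 /\ has_pole_divisor R f u].

Definition nabla r (R : 'I_r -> place iota) (i : 'I_r) (u : 'I_r -> nat) :
    set ('I_r -> nat) :=
  [set p | Wsemigroup R p /\ p i = u i].

Definition minimal_in r (A : set ('I_r -> nat)) (u : 'I_r -> nat) : Prop :=
  A u /\ forall p, A p -> (forall i, (p i <= u i)%N) -> p = u.

Definition min_gen_set r (R : 'I_r -> place iota) : set ('I_r -> nat) :=
  [set u | (forall i, (0 < u i)%N) /\ exists i, minimal_in (nabla R i u) u].

Definition vanishes_at (Q : place iota) (f : K) : Prop := f = 0 \/ 0 < Q f.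

(** The place Q lies over the point of P^3(F) with homogeneous coordinates
    P = (X : Y : Z : T) on the curve with affine generic point (x, y, z): some
    rescaling of (x : y : z : 1) is integral at Q and reduces to P.  The
    vector P is meant to be nonzero; lam absorbs its scaling. *)
Definition centered_at (x y z : K) (Q : place iota) (P : 'rV[F]_4) : Prop :=
  exists lam : K, lam != 0 /\
    forall i : 'I_4,
      vanishes_at Q (lam * [:: x; y; z; 1]`_i - iota (P 0 i)).

End FunctionField.

Definition hpoint (F : fieldType) (X Y Z T : F) : 'rV[F]_4 :=
  \row_(i < 4) [:: X; Y; Z; T]`_i.

Definition GK_h (R : comNzRingType) (n : nat) (X : R) : R :=
  \sum_(i < n.+1) (-1) ^+ i.+1 * X ^+ (i * (n - 1)).

Definition GK_equations (R : comNzRingType) (n : nat) (X Y Z : R) : Prop :=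
  Z ^+ (n ^ 2 - n + 1) = Y * GK_h n X /\ X ^+ n + X = Y ^+ n.+1.

(** K is the function field F(x, y, z) of GK: K has no proper subfield
    containing F, x, y and z.  Since T^(n+1) - (x^n + x) is irreducible over
    F(x) and T^(n^2-n+1) - y h(x) over F(x, y), these conditions determine
    (K, x, y, z) up to isomorphism. *)
Definition GK_function_field (n : nat) (F K : fieldType)
    (iota : {rmorphism F -> K}) (x y z : K) : Prop :=
  [/\ ~ algebraicOver iota x,
      GK_equations n x y z &
      forall S : {pred K}, divring_closed S ->
        (forall k : F, iota k \in S) -> x \in S -> y \in S -> z \in S ->
        forall f : K, f \in S].

Definition ord_cons (T : Type) (m : nat) (t : T) (s : 'I_m -> T) (i : 'I_m.+1) : T :=
  if unlift ord0 i is Some j then s j else t.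

(** Integer-valued so that subtraction is not truncated. *)
Definition GK_Gamma (n m : nat) : set ('I_m.+1 -> nat) :=
  let a : int := n%:Z ^+ 2 - n%:Z + 1 in
  let b : int := n%:Z ^+ 3 in
  let c : int := n%:Z ^+ 3 + 1 in
  [set u | exists (k i : int) (j : 'I_m -> int),
    let u0 : int := (n%:Z ^+ 2 - m%:Z - \sum_(s < m) j s) * c
                    - i * n%:Z * a - k * b in
    [/\ 1 <= k <= a, 0 <= i <= n%:Z, forall s, 0 <= j s, 0 < u0 &
        (u ord0)%:Z = u0 /\
        forall s : 'I_m, (u (lift ord0 s))%:Z = j s * c + i * a + k]].

Arguments GK_Gamma : clear implicits.

(* Main.v *)
(** Put [a = n^2 - n + 1] and [c = n^3 + 1 = (n + 1) a].  Since [n = 0] in [F],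
    [h(x) (x^n + x) = x^(n^2) - x], so that [K = F(x)(z)] is the Kummer extension
    [z^c = (x^n + x) h(x)^(n+1)], with [y = z^a / h(x)] and with [F] containing
    the [c]-th roots of unity.  At [P_infty] and at each [P_j] the terms
    [z^l g_l(x)], [l < c], have pairwise distinct values mod [c]; hence the value
    of a sum of such terms is the least of their values, and there is only one
    place over each of these points.  The Galois group permutes the places and
    fixes [P_infty] and the [P_j], so the components [z^l g_l(x)] of a function
    regular elsewhere are regular elsewhere too.  Writing [l = i a + k], such a
    component has at the [P_s] the values of [y^i z^k \prod_s (x - a_s)^(-e_s)] and
    at [P_infty] a pole order larger by [c d] with [d >= 0].  To see [d >= 0] one
    needs a place over every irreducible polynomial in [x]: it is obtained from a
    maximal subring of [K] omitting the inverse of that polynomial.  So the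
    semigroup consists of least upper bounds of pole vectors of these monomials,
    and comparing pole vectors is elementary. *)
Require Import Defs.
From HB Require Import structures.
From mathcomp Require Import all_boot all_order all_algebra.
From mathcomp Require Import cyclic separable finfield.
From mathcomp Require Import boolp classical_sets.
From mathcomp Require Import zify ring.

Set Implicit Arguments.
Unset Strict Implicit.
Unset Printing Implicit Defensive.

Import Order.TTheory GRing.Theory Num.Theory.

Local Open Scope classical_set_scope.
Local Open Scope ring_scope.

(** * Calculus of the valuations attached to places *)

Section PlaceTheory.
Variables (F K : fieldType) (iota : {rmorphism F -> K}).
Implicit Types (Q : place iota) (f g : K).

Lemma pval1 Q : Q 1 = 0.
Proof. by rewrite -(rmorph1 iota) pvalC ?oner_eq0. Qed.

Lemma pvalN Q f : Q (- f) = Q f.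
Proof.
have [->|f0] := eqVneq f 0; first by rewrite oppr0.
have E : - f = iota (-1) * f by rewrite rmorphN1 mulN1r.
have n1 : (-1 : F) != 0 by rewrite oppr_eq0 oner_eq0.
by rewrite E pvalM ?fmorph_eq0 // pvalC // add0r.
Qed.

Lemma pvalV Q f : Q f^-1 = - Q f.
Proof.
have [->|f0] := eqVneq f 0; first by rewrite invr0 pval0 oppr0.
by apply/eqP; rewrite -subr_eq0 opprK addrC -pvalM ?invr_eq0 // mulfV // pval1.
Qed.

Lemma pvalX Q f k : Q (f ^+ k) = k%:Z * Q f.
Proof.
have [->|f0] := eqVneq f 0.
  by rewrite pval0 mulr0 expr0n; case: eqP => _; rewrite ?pval1 ?pval0.
elim: k => [|k IH]; first by rewrite expr0 pval1 mul0r.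
by rewrite exprS pvalM ?expf_neq0 // IH; lia.
Qed.

Lemma pvalXz Q f (k : int) : Q (f ^ k) = k * Q f.
Proof. by case: k => k; rewrite /exprz ?NegzE ?pvalV pvalX //; lia. Qed.

Lemma pval_div Q f g : f != 0 -> g != 0 -> Q (f / g) = Q f - Q g.
Proof. by move=> f0 g0; rewrite pvalM ?invr_eq0 // pvalV. Qed.

Lemma pval_prod Q (I : Type) (r : seq I) (f : I -> K) :
  (forall i, f i != 0) -> Q (\prod_(i <- r) f i) = \sum_(i <- r) Q (f i).
Proof.
move=> f0; elim: r => [|i r IH]; first by rewrite !big_nil pval1.
rewrite !big_cons pvalM ?IH //; elim/big_ind: _ => // [|? ? ? ?].
  exact: oner_neq0.
exact: mulf_neq0.
Qed.

Definition vge Q (v : int) f := f = 0 \/ v <= Q f.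

Lemma vgeD Q v f g : vge Q v f -> vge Q v g -> vge Q v (f + g).
Proof.
move=> [->|Hf]; first by rewrite add0r.
move=> [->|Hg]; first by rewrite addr0; right.
have [->|f0] := eqVneq f 0; first by rewrite add0r; right.
have [->|g0] := eqVneq g 0; first by rewrite addr0; right.
have [->|fg] := eqVneq (f + g) 0; first by left.
by right; apply: le_trans (pvalD Q f0 g0 fg); rewrite le_min Hf Hg.
Qed.

Lemma vge_sum Q v (I : Type) (r : seq I) (P : pred I) (f : I -> K) :
  (forall i, P i -> vge Q v (f i)) -> vge Q v (\sum_(i <- r | P i) f i).
Proof. by move=> H; elim/big_ind: _ => //; [left | exact: vgeD]. Qed.

Lemma pval_nneg_sum Q (I : Type) (r : seq I) (P : pred I) (f : I -> K) :
  (forall i, P i -> 0 <= Q (f i)) -> 0 <= Q (\sum_(i <- r | P i) f i).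
Proof.
move=> H; have [|->|//] := @vge_sum Q 0 I r P f; last by rewrite pval0.
by move=> i /H; right.
Qed.

(** Writing [f = (f + g) - g] bounds the value of [f + g] from above; the bound from below is the
    ultrametric inequality. *)
Lemma pvalD_lt Q f g : f != 0 -> vge Q (Q f + 1) g -> f + g != 0 /\ Q (f + g) = Q f.
Proof.
move=> f0 [->|lt_fg]; first by rewrite addr0.
have [->|g0] := eqVneq g 0; first by rewrite addr0.
have fg : f + g != 0.
  apply/eqP => /eqP; rewrite addr_eq0 => /eqP fE.
  by move: lt_fg; rewrite fE pvalN; lia.
have ng : - g != 0 by rewrite oppr_eq0.
have := pvalD Q fg ng; rewrite addrK pvalN ge_min => /(_ f0) le_f.
have := pvalD Q f0 g0 fg; rewrite ge_min => le_fg; split=> //.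
move: lt_fg le_f le_fg; set v := Q f; set v' := Q g; set v'' := Q (f + g).
lia.
Qed.

(** The nonzero term of least value strictly dominates the sum of all the others, so [pvalD_lt]
    applies. *)
Lemma pval_sum_distinct Q n (t : 'I_n -> K) :
    (forall i j, t i != 0 -> t j != 0 -> Q (t i) = Q (t j) -> i = j) ->
    (exists i, t i != 0) ->
  exists i, [/\ t i != 0, \sum_j t j != 0, Q (\sum_j t j) = Q (t i) &
    forall j, t j != 0 -> Q (t i) <= Q (t j)].
Proof.
move=> dist [i0 ti0]; exists [arg min_(i < i0 | t i != 0) Q (t i)]%O.
case: arg_minP => // i ti min_i.
have [||s0 sE] := @pvalD_lt Q (t i) (\sum_(j | j != i) t j) => //.
  apply: vge_sum => j ji; have [->|tj] := eqVneq (t j) 0; first by left.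
  right; have := min_i j tj.
  suff : Q (t i) <> Q (t j) by move=> ? ?; lia.
  by move=> /dist H; rewrite H ?eqxx in ji.
by rewrite (bigD1 i) //=.
Qed.

Lemma place_eq Q Q' : (forall f, f != 0 -> Q f = Q' f) -> Q = Q'.
Proof.
case: Q Q' => [v v0 vM vD vC vS] [v' v0' vM' vD' vC' vS'] /= E.
have {}E : v = v'.
  by apply/funext => f; have [->|/E] := eqVneq f 0; first by rewrite v0 v0'.
by subst v'; congr Place; apply: Prop_irrelevance.
Qed.

End PlaceTheory.

(** * Subrings of a field, and those maximal among the subrings omitting a given element *)

Definition subring_set (K : fieldType) (A : set K) : Prop :=
  [/\ A 1, forall f g, A f -> A g -> A (f - g) &
      forall f g, A f -> A g -> A (f * g)].

Section SubringSet.
Variables (K : fieldType) (A : set K).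
Hypothesis A_ring : subring_set A.

Lemma subring1 : A 1. Proof. by case: A_ring. Qed.
Lemma subringB f g : A f -> A g -> A (f - g). Proof. by case: A_ring => _ + _; apply. Qed.
Lemma subringM f g : A f -> A g -> A (f * g). Proof. by case: A_ring => _ _; apply. Qed.
Lemma subring0 : A 0. Proof. by rewrite -(subrr 1); apply: subringB; exact: subring1. Qed.
Lemma subringN f : A f -> A (- f).
Proof. by rewrite -sub0r; apply: subringB; exact: subring0. Qed.
Lemma subringD f g : A f -> A g -> A (f + g).
Proof. by move=> Af Ag; rewrite -(opprK g); apply: subringB => //; exact: subringN. Qed.
Lemma subringX f k : A f -> A (f ^+ k).
Proof.
by move=> Af; elim: k => [|k IH]; [exact: subring1 | rewrite exprS; exact: subringM].
Qed.
Lemma subring_sum (I : Type) (r : seq I) (P : pred I) (f : I -> K) :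
  (forall i, P i -> A (f i)) -> A (\sum_(i <- r | P i) f i).
Proof. by move=> H; elim/big_ind: _ => //; [exact: subring0 | exact: subringD]. Qed.

Definition adjoin (u : K) : set K :=
  [set f | exists p : {poly K}, (forall i, A p`_i) /\ p.[u] = f].

Lemma adjoin_subring u : subring_set (adjoin u).
Proof.
split.
- exists 1; split; last by rewrite hornerC.
  by move=> i; rewrite coef1; case: eqP => _; [exact: subring1 | exact: subring0].
- move=> _ _ [p [pA <-]] [q [qA <-]]; exists (p - q); split; last by rewrite hornerD hornerN.
  by move=> i; rewrite coefB; apply: subringB.
- move=> _ _ [p [pA <-]] [q [qA <-]]; exists (p * q); split; last by rewrite hornerM.
  by move=> i; rewrite coefM; apply: subring_sum => j _; apply: subringM.
Qed.

Lemma sub_adjoin u : A `<=` adjoin u.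
Proof.
move=> f Af; exists f%:P; rewrite hornerC; split=> // i; rewrite coefC.
by case: eqP => _ //; exact: subring0.
Qed.

Lemma mem_adjoin u : adjoin u u.
Proof.
exists 'X; rewrite hornerX; split=> // i; rewrite coefX.
by case: eqP => _; [exact: subring1 | exact: subring0].
Qed.

End SubringSet.

(* Chevalley's argument: a subring maximal among those omitting [t^-1] is a
   valuation ring. *)
Section MaximalSubring.
Variables (K : fieldType) (A : set K) (t : K).
Hypotheses (A_ring : subring_set A) (At : A t) (t_neq0 : t != 0).
Hypothesis At' : ~ A t^-1.
Hypothesis A_max :
  forall B, subring_set B -> A `<=` B -> ~ B t^-1 -> B `<=` A.

(** The element [t] behaves like a member of the Jacobson radical. Let [s = 1 + t * b]. If [s^-1]
    were outside [A], maximality would put [t^-1] in [A[s^-1]]. Multiplying by a power of [s], which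
    is 1 modulo [t A], would bring [t^-1] back into [A]. *)
Lemma maximal_subring_inv b : A b -> 1 + t * b != 0 /\ A (1 + t * b)^-1.
Proof.
move=> Ab; have s0 : 1 + t * b != 0.
  apply/eqP => E; apply: At'.
  have -> : t^-1 = - b.
    by apply: (mulfI t_neq0); apply/eqP; rewrite mulfV // mulrN -addr_eq0 E.
  exact: subringN.
split=> //; set s := 1 + t * b in s0 *; apply: contrapT => As.
have [p [pA pE]] : adjoin A s^-1 t^-1.
  apply: contrapT => /(A_max (adjoin_subring A_ring _) (@sub_adjoin _ _ A_ring _)).
  by move=> /(_ _ (mem_adjoin A_ring _)).
have [b' Ab' sE] : exists2 b', A b' & s ^+ size p = 1 + t * b'.
  elim: (size p) => [|k [b' Ab' IH]].
    by exists 0; rewrite ?mulr0 ?addr0 ?expr0 //; exact: subring0.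
  exists (b + b' + t * b * b'); last by rewrite exprS IH /s; ring.
  by do !apply: subringD => //; do !apply: subringM.
have [w Aw wE] : exists2 w, A w & s ^+ size p * t^-1 = w.
  eexists; last by [].
  rewrite -pE horner_coef mulr_sumr; apply: subring_sum => // i _.
  rewrite mulrCA exprVn -expfB //; apply: subringM => //.
  by apply: subringX => //; apply: subringD => //; [exact: subring1 | exact: subringM].
apply: At'; have -> : t^-1 = w - b' by rewrite -wE sE; field.
exact: subringB.
Qed.

Let S u k := exists p : {poly K},
  [/\ forall i, A p`_i, (size p <= k)%N & t * p.[u] = 1].

Let reduce u k : u != 0 -> S u k.+1 -> S u^-1 k.+1 -> S u k.
Proof.
move=> u0 [p [pA sp pE]] [r [rA sr rE]].
have [] := @maximal_subring_inv (- r`_0); first exact: subringN.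
set s := 1 + _ => s0 As.
have uE : u ^+ k = t * \sum_(i < k) (s^-1 * r`_(k - i)) * u ^+ i.
  move: rE; rewrite (horner_coef_wide _ sr) big_ord_recl expr0 mulr1 => rE.
  apply: (mulfI s0); rewrite {1}/s mulrN -{1}rE mulrDr addrAC subrr add0r.
  rewrite -mulrA [RHS]mulrCA; congr (_ * _); rewrite mulr_suml mulr_sumr.
  rewrite (reindex_inj rev_ord_inj) /=; apply: eq_bigr => i _.
  rewrite /bump /= add1n subnSK ?ltn_ord // exprVn.
  have -> : u ^+ k = u ^+ (k - i) * u ^+ i by rewrite -exprD subnK // ltnW.
  by field; rewrite s0 expf_neq0.
exists (\poly_(i < k) (p`_i + p`_k * t * (s^-1 * r`_(k - i)))); split.
- move=> i; rewrite coef_poly; case: ifP => _; last exact: subring0.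
  by apply: subringD => //; do !apply: subringM.
- exact: size_poly.
rewrite -pE horner_poly (horner_coef_wide _ sp) big_ord_recr /= uE.
congr (_ * _); rewrite !mulr_sumr -big_split /=; apply: eq_bigr => i _; ring.
Qed.

(** If both were outside [A], maximality would give relations [1 = t p(u)] and [1 = t r(u^-1)].
    Padded to a common length, they shrink together by [reduce], down to the absurd length 0. *)
Lemma maximal_subring_valuation u : A u \/ A u^-1.
Proof.
have [->|u0] := eqVneq u 0; first by left; exact: subring0.
apply: contrapT => /not_orP [Au Au'].
have adjS v : ~ A v -> exists k, S v k.
  move=> Av; have [p [pA pE]] : adjoin A v t^-1.
    apply: contrapT => /(A_max (adjoin_subring A_ring _) (@sub_adjoin _ _ A_ring _)).
    by move=> /(_ _ (mem_adjoin A_ring _)).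
  by exists (size p), p; split=> //; rewrite pE mulfV.
have Smon v k k' : (k <= k')%N -> S v k -> S v k'.
  by move=> kk [p [pA sp pE]]; exists p; split=> //; exact: leq_trans kk.
have [k Sk] := adjS _ Au; have [k' Sk'] := adjS _ Au'.
have {Sk Sk'} [] : S u (maxn k k') /\ S u^-1 (maxn k k').
  by split; [apply: Smon Sk; exact: leq_maxl | apply: Smon Sk'; exact: leq_maxr].
elim: (maxn k k') => [|l IH] Su Su'.
  case: Su => p [_]; rewrite leqn0 size_poly_eq0 => /eqP -> /esym/eqP.
  by rewrite horner0 mulr0 oner_eq0.
apply: IH; apply: reduce => //; first by rewrite invr_eq0.
by rewrite invrK.
Qed.

End MaximalSubring.

Lemma exists_maximal_subring (K : fieldType) (A0 : set K) (t : K) :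
    subring_set A0 -> ~ A0 t^-1 ->
  exists A, [/\ subring_set A, A0 `<=` A, ~ A t^-1 &
    forall B, subring_set B -> A `<=` B -> ~ B t^-1 -> B `<=` A].
Proof.
move=> ring0 A0t.
pose P (A : set K) := A = set0 \/ [/\ subring_set A, A0 `<=` A & ~ A t^-1].
have [C CP Ctot|A [PA Amax]] := @Zorn_bigcup K P.
  have [[A [CA An0]]|allC] := pselect (exists A, C A /\ A !=set0); last first.
    left; apply/seteqP; split=> // f [B CB Bf]; apply: allC; exists B; split=> //.
    by exists f.
  have good B : C B -> B !=set0 -> [/\ subring_set B, A0 `<=` B & ~ B t^-1].
    by move=> CB [f Bf]; case: (CP _ CB) => // B0; rewrite B0 in Bf.
  have both f g : (\bigcup_(X in C) X) f -> (\bigcup_(X in C) X) g ->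
      exists B, [/\ C B, B f & B g].
    move=> [B CB Bf] [B' CB' B'g]; case: (Ctot _ _ CB CB') => sub.
      by exists B'; split=> //; exact: sub.
    by exists B; split=> //; exact: sub.
  right; have [Ar A0A At] := good _ CA An0; split.
  - split; first by exists A => //; exact: subring1.
    + move=> f g Cf Cg; have [B [CB Bf Bg]] := both _ _ Cf Cg.
      have [|Br _ _] := good _ CB; first by exists f.
      by exists B => //; exact: subringB.
    + move=> f g Cf Cg; have [B [CB Bf Bg]] := both _ _ Cf Cg.
      have [|Br _ _] := good _ CB; first by exists f.
      by exists B => //; exact: subringM.
  - by move=> f /A0A Af; exists A.
  - move=> [B CB Bt]; have [|_ _] := good _ CB; first by exists t^-1.
    by apply.
have PA0 : P A0 by right; split.
have A01 : A0 1 by exact: subring1.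
case: PA => [A_0|[Ar A0A At]].
  exfalso; apply: (Amax A0) => //; split; first by rewrite A_0.
  by move=> /(_ _ A01); rewrite A_0.
exists A; split=> // B Br AB Bt; apply: contrapT => BA.
by apply: (Amax B); [split | right; split=> //; exact: subset_trans AB].
Qed.

Ltac field_nz :=
  field; repeat (apply/andP; split);
  rewrite ?mulf_neq0 ?expf_neq0 ?expfz_neq0 ?invr_eq0 //.

(** * Valuation rings: comparison of values through quotients *)

Section ValuationRing.
Variables (K : fieldType) (A : set K).
Hypothesis A_ring : subring_set A.
Hypothesis A_val : forall u, A u \/ A u^-1.

(** Before an integer valuation is available, two nonzero elements count as having equal values when
    their quotient is a [vunit], and [A (g / f)] says that the value of [f] is at most that of
    [g]. *)
Definition vunit f := [/\ f != 0, A f & A f^-1].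
Definition nonunit f := A f /\ (f = 0 \/ ~ A f^-1).

Lemma vunit1 : vunit 1.
Proof. by split; rewrite ?invr1 ?oner_neq0 //; exact: subring1. Qed.

Lemma vunitM f g : vunit f -> vunit g -> vunit (f * g).
Proof.
move=> [f0 Af Af'] [g0 Ag Ag']; split; first exact: mulf_neq0.
  exact: subringM.
by rewrite invfM; exact: subringM.
Qed.

Lemma vunitV f : vunit f -> vunit f^-1.
Proof. by move=> [f0 Af Af']; split; rewrite ?invrK ?invr_eq0. Qed.

Lemma vunitX f k : vunit f -> vunit (f ^+ k).
Proof.
by move=> Uf; elim: k => [|k IH]; [exact: vunit1 | rewrite exprS; exact: vunitM].
Qed.

Lemma vunit_nonunit f : vunit f -> nonunit f -> False.
Proof. by move=> [f0 _ Af'] [_ [fE|]] //; rewrite fE eqxx in f0. Qed.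

Lemma nonunit0 : nonunit 0.
Proof. by split; [exact: subring0 | left]. Qed.

Lemma nonunitM f g : nonunit f -> A g -> nonunit (f * g).
Proof.
move=> [Af [->|Af']] Ag; first by rewrite mul0r; exact: nonunit0.
split; first exact: subringM.
have [->|f0] := eqVneq f 0; first by left; rewrite mul0r.
have [->|g0] := eqVneq g 0; first by left; rewrite mulr0.
right=> Afg; apply: Af'; have -> : f^-1 = g * (f * g)^-1 by rewrite invfM mulrCA mulfV // mulr1.
exact: subringM.
Qed.

Let nonunitD_wlog f g : f != 0 -> g != 0 -> A (f / g) -> nonunit f -> nonunit g ->
  nonunit (f + g).
Proof.
move=> f0 g0 Afg nf ng; have -> : f + g = g * (f / g + 1) by field_nz.
by apply: nonunitM => //; apply: subringD => //; exact: subring1.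
Qed.

Lemma nonunitD f g : nonunit f -> nonunit g -> nonunit (f + g).
Proof.
have [->|f0] := eqVneq f 0; first by rewrite add0r.
have [->|g0] := eqVneq g 0; first by rewrite addr0.
move=> nf ng; have [Afg|] := A_val (f / g); first exact: nonunitD_wlog.
by rewrite invf_div => ?; rewrite addrC; exact: nonunitD_wlog.
Qed.

Lemma nonunit_sum (I : Type) (r : seq I) (P : pred I) (f : I -> K) :
  (forall i, P i -> nonunit (f i)) -> nonunit (\sum_(i <- r | P i) f i).
Proof. by move=> H; elim/big_ind: _ => //; [exact: nonunit0 | exact: nonunitD]. Qed.

Lemma nonunit_ratio f g : f != 0 -> g != 0 -> A (f / g) -> ~ vunit (f / g) ->
  nonunit (f / g).
Proof.
move=> f0 g0 Afg Ufg; split=> //; right=> Agf; apply: Ufg; split=> //.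
by rewrite mulf_neq0 ?invr_eq0.
Qed.

Lemma min_value (I : eqType) (s : seq I) (t : I -> K) :
  (forall i, i \in s -> t i != 0) -> s != [::] ->
  exists2 i, i \in s & forall j, j \in s -> A (t j / t i).
Proof.
elim: s => // i0 [|i1 s] IH t0 _.
  exists i0 => [|j]; rewrite ?mem_head // inE => /eqP ->.
  by rewrite mulfV ?t0 ?mem_head //; exact: subring1.
have [||i si mini] := IH => //; first by move=> i si; apply: t0; rewrite in_cons si orbT.
have ti : t i != 0 by apply: t0; rewrite in_cons si orbT.
have ti0 : t i0 != 0 by apply: t0; rewrite mem_head.
have [Ai|Ai] := A_val (t i0 / t i).
  exists i => [|j]; first by rewrite in_cons si orbT.
  by rewrite in_cons => /orP [/eqP ->|/mini].
rewrite invf_div in Ai; exists i0 => [|j]; first by rewrite mem_head.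
rewrite in_cons => /orP [/eqP ->|sj]; first by rewrite mulfV //; exact: subring1.
have -> : t j / t i0 = t j / t i * (t i / t i0) by rewrite mulrA divfK.
by apply: subringM => //; exact: mini.
Qed.

(** If the term of least value shared its value with no other term, dividing by it would write -1 as
    a sum of nonunits. *)
Lemma sum0_equiv n (t : 'I_n -> K) : \sum_i t i = 0 -> (exists i, t i != 0) ->
  exists i j : 'I_n, [/\ (i < j)%N, t i != 0, t j != 0 & vunit (t i / t j)].
Proof.
move=> sum0 [i1 ti1].
pose s := [seq i <- enum 'I_n | t i != 0].
have sP i : (i \in s) = (t i != 0) by rewrite mem_filter mem_enum andbT.
have [||i si mini] := @min_value _ s t.
- by move=> i; rewrite sP.
- by apply/eqP => sE; move: (sP i1); rewrite sE ti1.
rewrite sP in si; apply: contrapT => H.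
have nj j : j != i -> nonunit (t j / t i).
  move=> ji; have [->|tj] := eqVneq (t j) 0; first by rewrite mul0r; exact: nonunit0.
  apply: nonunit_ratio => //; first by apply: mini; rewrite sP.
  move=> U; apply: H; case: (ltngtP i j) => [ij|ij|/val_inj ij].
  - exists i, j; split=> //; rewrite -[_ / _]invf_div; exact: vunitV.
  - by exists j, i.
  - by rewrite ij eqxx in ji.
have /vunit_nonunit : vunit (- 1).
  split; rewrite ?oppr_eq0 ?oner_neq0 ?invrN ?invr1 //; apply: subringN => //; exact: subring1.
apply; have -> : -1 = \sum_(j | j != i) t j / t i.
  apply: (mulIf si); rewrite mulN1r mulr_suml; apply/eqP.
  rewrite eq_sym -addr_eq0; move: sum0; rewrite (bigD1 i) //= addrC => sum0.
  rewrite -[X in _ == X]sum0; apply/eqP; congr (_ + _).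
  by apply: eq_bigr => j _; field.
exact: nonunit_sum.
Qed.

End ValuationRing.

(** * Existence of a place over a nonconstant polynomial *)

Section PlaceExtension.
Variables (F K : fieldType) (iota : {rmorphism F -> K}).
Variable ev : {rmorphism {poly F} -> K}.
Hypothesis ev_inj : injective ev.
Hypothesis evC : forall k, ev k%:P = iota k.
Variable c : nat.
Hypothesis algebraic : forall f : K, exists p : {poly {poly F}},
  [/\ p != 0, (size p <= c.+1)%N & (map_poly ev p).[f] = 0].

Let ev_eq0 P : (ev P == 0) = (P == 0).
Proof. by rewrite -(rmorph0 ev) (inj_eq ev_inj). Qed.

Section Discrete.
Variable A : set K.
Hypotheses (A_ring : subring_set A) (A_val : forall u, A u \/ A u^-1).
Hypothesis evA : forall P, A (ev P).
Variable M : {poly F}.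
Hypotheses (M_neq0 : M != 0) (AM : ~ A (ev M)^-1).

Local Notation U := (vunit A).
Local Notation nonU := (nonunit A).

Let nonconst P : P != 0 -> ~ A (ev P)^-1 -> (1 < size P)%N.
Proof.
move=> P0 AP; rewrite ltnNge; apply/negP => /size1_polyC PE; apply: AP.
by rewrite PE evC -fmorphV -evC; exact: evA.
Qed.

(** The polynomial [pi] generates the prime ideal of [F[x]] below the maximal ideal of [A]. It is
    chosen of least degree among the polynomials whose inverse is outside [A], so it divides each of
    them: a nonzero remainder would be a smaller one. *)
Lemma exists_center_poly : exists2 pi : {poly F}, pi != 0 /\ ~ A (ev pi)^-1 &
  forall P, P != 0 -> exists k : nat, U (ev P / ev pi ^+ k).
Proof.
have ex : exists k, `[< exists P : {poly F}, [/\ size P = k, P != 0 & ~ A (ev P)^-1] >].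
  by exists (size M); apply/asboolP; exists M.
case: (ex_minnP ex) => k /asboolP [pi [<- pi0 Api]] {k} min_pi.
exists pi => // P; have [k] := ubnP (size P); elim: k P => // k IH P sP P0.
have [AP|AP] := pselect (A (ev P)^-1).
  by exists 0; rewrite expr0 divr1; split; rewrite ?ev_eq0.
have sPE := divp_eq P pi.
have ev_pi : ev pi != 0 by rewrite ev_eq0.
have r0 : P %% pi = 0.
  apply: contrapT => /eqP r0; have := min_pi (size (P %% pi)).
  rewrite leqNgt ltn_modp pi0 => H; suff /H : `[< exists P' : {poly F}, [/\ size P' = size (P %% pi), P' != 0 & ~ A (ev P')^-1] >] by [].
  apply/asboolP; exists (P %% pi); split=> // Ar.
  have : nonU (ev (P %% pi)).
    have -> : ev (P %% pi) = ev P + ev pi * ev (- (P %/ pi)).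
      by rewrite {2}sPE rmorphN rmorphD rmorphM /=; ring.
    by apply: nonunitD => //; [|apply: nonunitM => //]; split=> //; right.
  by move=> [_ [/eqP|//]]; rewrite ev_eq0 (negPf r0).
rewrite r0 addr0 in sPE.
have q0 : P %/ pi != 0 by apply: contra_neq P0 => q0; rewrite sPE q0 mul0r.
have [|j Uj] := IH _ _ q0.
  have := nonconst pi0 Api; move: sP; rewrite {1}sPE size_mul //.
  have : (0 < size (P %/ pi)%R)%N by rewrite lt0n size_poly_eq0.
  set s1 := size (P %/ pi); set s2 := size pi. lia.
exists j.+1; rewrite {1}sPE rmorphM /=; move: Uj; congr (vunit A _).
by rewrite exprSr; field_nz.
Qed.

(** Every [f] satisfies an equation of degree at most [c] over [F[x]]. If [f] is nonzero, two terms
    of the equation have equal values by [sum0_equiv], so some power of [f] with exponent at most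
    [c] is a unit times a power of [t]. Hence the values, in units of the value of [t], have bounded
    denominators and form a cyclic group. *)
Lemma discrete_place : exists Q : place iota,
  (forall f, A f -> 0 <= Q f) /\ (forall P, P != 0 -> ~ A (ev P)^-1 -> 0 < Q (ev P)).
Proof.
have [pi [pi0 Api] piP] := exists_center_poly.
set t := ev pi in Api piP; have t0 : t != 0 by rewrite ev_eq0.
have At (k : int) : A (t ^ k) <-> 0 <= k.
  have Atk (k' : nat) : A (t ^+ k') by apply: subringX => //; exact: evA.
  split; last by case: k => // k _; exact: Atk.
  case: k => // k; rewrite NegzE -invr_expz => Ak; exfalso; apply: Api.
  have -> : t^-1 = t ^+ k * (t ^ k.+1)^-1 by rewrite -exprnP exprSr; field_nz.
  exact: subringM.
have Ut (k : int) : U (t ^ k) -> k = 0.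
  by move=> [_ /At k0]; rewrite invr_expz => /At; lia.
have power f : f != 0 -> exists N, [/\ (0 < N)%N, (N <= c)%N & exists k : int, U (f ^+ N / t ^ k)].
  move=> f0; have [p [p0 sp pf]] := algebraic f.
  have sp' : (size (map_poly ev p) <= c.+1)%N by rewrite size_map_inj_poly ?rmorph0 //.
  rewrite (horner_coef_wide _ sp') in pf.
  have tE (i : 'I_c.+1) : ((map_poly ev p)`_i * f ^+ i != 0) = (p`_i != 0).
    by rewrite mulf_eq0 (negPf (expf_neq0 _ f0)) orbF coef_map ev_eq0.
  have [|i [j [ij]]] := sum0_equiv A_ring A_val pf.
    have slt : ((size p).-1 < c.+1)%N by case: (size p) sp => // k; exact: ltnW.
    by exists (Ordinal slt); rewrite tE -/(lead_coef p) lead_coef_eq0.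
  rewrite !tE !coef_map => pi_0 pj_0 /= /vunitV Uij.
  have [ki Ui] := piP _ pi_0; have [kj Uj] := piP _ pj_0.
  exists (j - i)%N; split; first by rewrite subn_gt0.
    by have := ltn_ord j; lia.
  exists (ki%:Z - kj%:Z).
  have := vunitM A_ring (vunitM A_ring Uij Ui) (vunitV Uj).
  congr (vunit A _); rewrite expfB // expfzDr // -invr_expz -!exprnP.
  by field_nz; rewrite ?ev_eq0.
(* The factorial is a common multiple of all the exponents given by [power]. Thus [phi f] below is
   [N] times the value of [f], in units where [t] has value 1. *)
pose N := c`!; have N_gt0 : (0 < N)%N by exact: fact_gt0.
have exphi f : exists k : int, f != 0 -> U (f ^+ N / t ^ k).
  have [->|f0] := eqVneq f 0; first by exists 0.
  have [N' [N'0 N'c [k Uk]]] := power f f0.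
  have /dvdnP [l NE] : (N' %| N)%N by rewrite dvdn_fact // N'0.
  exists (k * l%:Z) => _; have := vunitX A_ring l Uk.
  by congr (vunit A _); rewrite expr_div_n -exprM mulnC -NE -exprz_exp.
have /choice [phi phiP] := exphi.
have phi_uniq f k : f != 0 -> U (f ^+ N / t ^ k) -> phi f = k.
  move=> f0 Uk; apply/eqP; rewrite -subr_eq0; apply/eqP; apply: Ut.
  have := vunitM A_ring Uk (vunitV (phiP _ f0)).
  congr (vunit A _); rewrite expfzDr // -invr_expz.
  by field_nz; rewrite ?ev_eq0.
have phiM f g : f != 0 -> g != 0 -> phi (f * g) = phi f + phi g.
  move=> f0 g0; apply: phi_uniq; first exact: mulf_neq0.
  have := vunitM A_ring (phiP _ f0) (phiP _ g0).
  congr (vunit A _); rewrite expfzDr // exprMn.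
  by field_nz; rewrite ?ev_eq0.
have phi_ge0 f : f != 0 -> A f <-> 0 <= phi f.
  move=> f0; have [_ Uf Uf'] := phiP _ f0; split=> [Af|/At Ak].
    apply/At; have -> : t ^ phi f = f ^+ N * (f ^+ N / t ^ phi f)^-1.
      by field_nz.
    by apply: subringM => //; exact: subringX.
  have AfN : A (f ^+ N).
    have -> : f ^+ N = (f ^+ N / t ^ phi f) * t ^ phi f by field_nz.
    exact: subringM.
  have [//|Af'] := A_val f.
  have -> : f = f ^+ N * f^-1 ^+ N.-1.
    by rewrite exprVn -[in f ^+ N](prednK N_gt0) exprS mulfK ?expf_neq0.
  by apply: subringM => //; exact: subringX.
have phi1 : phi 1 = 0 by have := phiM 1 1 (oner_neq0 _) (oner_neq0 _); rewrite mulr1; lia.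
have phiV f : f != 0 -> phi f^-1 = - phi f.
  by move=> f0; have := phiM f f^-1 f0; rewrite invr_eq0 mulfV // phi1 => /(_ f0); lia.
have phiX f k : f != 0 -> phi (f ^+ k) = k%:Z * phi f.
  move=> f0; elim: k => [|k IH]; first by rewrite expr0 phi1 mul0r.
  by rewrite exprS phiM ?expf_neq0 // IH; lia.
have phiXz f (k : int) : f != 0 -> phi (f ^ k) = k * phi f.
  move=> f0; case: k => k; rewrite /exprz ?NegzE ?phiV ?expf_neq0 // phiX //; lia.
have phiD_wlog f g : f != 0 -> g != 0 -> f + g != 0 -> phi f <= phi g -> phi f <= phi (f + g).
  move=> f0 g0 fg0 le_fg.
  have Agf : A (g / f).
    by apply/phi_ge0; rewrite ?mulf_neq0 ?invr_eq0 // phiM ?invr_eq0 // phiV //; lia.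
  have fgE : f + g = f * (1 + g / f) by field_nz.
  have u0 : 1 + g / f != 0 by apply: contra_neq fg0 => u0; rewrite fgE u0 mulr0.
  rewrite fgE phiM //.
  suff : 0 <= phi (1 + g / f) by lia.
  by apply/phi_ge0 => //; apply: subringD => //; exact: subring1.
have phiD f g : f != 0 -> g != 0 -> f + g != 0 -> Num.min (phi f) (phi g) <= phi (f + g).
  move=> f0 g0 fg0; rewrite ge_min; case: (lerP (phi f) (phi g)) => le_fg.
    by rewrite phiD_wlog.
  by rewrite addrC phiD_wlog ?orbT // 1?addrC // ltW.
have phi_pos P : P != 0 -> ~ A (ev P)^-1 -> 0 < phi (ev P).
  move=> P0 AP; have eP0 : ev P != 0 by rewrite ev_eq0.
  rewrite ltNge; apply/negP => le0; apply: AP.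
  by apply/phi_ge0; rewrite ?invr_eq0 // phiV //; lia.
have phiC k : k != 0 -> phi (iota k) = 0.
  move=> k0; have ik0 : iota k != 0 by rewrite fmorph_eq0.
  have := phi_ge0 _ ik0; rewrite -evC => -[/(_ (evA _)) + _].
  have ik0' : iota k^-1 != 0 by rewrite fmorph_eq0 invr_eq0.
  have := phi_ge0 _ ik0'; rewrite -[X in A X]evC => -[/(_ (evA _)) + _].
  by rewrite fmorphV phiV // -evC; lia.
(* The map [phi] need not be onto. Its least positive value [d] divides all its values, and dividing
   by [d] normalizes the valuation. *)
have ex : exists k, `[< exists f, [/\ f != 0, (0 < k)%N & phi f = k%:Z] >].
  exists (absz (phi (ev M))); apply/asboolP; exists (ev M); rewrite ev_eq0.
  by have := phi_pos M M_neq0 AM; split=> //; lia.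
case: (ex_minnP ex) => d /asboolP [t1 [t10 d0 t1E]] min_d.
have phi_dvd f : f != 0 -> phi f = (phi f %/ d%:Z)%Z * d%:Z.
  move=> f0; have rE := divz_eq (phi f) d%:Z.
  set q := (phi f %/ d%:Z)%Z in rE *; set r := (phi f %% d%:Z)%Z in rE.
  have r_ge0 : 0 <= r by apply: modz_ge0; lia.
  have r_lt : r < d%:Z by apply: ltz_pmod; lia.
  suff : r = 0 by lia.
  have g0 : f * t1 ^ (- q) != 0 by rewrite mulf_neq0 // expfz_neq0.
  have gE : phi (f * t1 ^ (- q)) = r by rewrite phiM ?expfz_neq0 // phiXz // t1E rE; ring.
  apply: contrapT => /eqP r0; have := min_d (absz r).
  have -> : `[< exists f0, [/\ f0 != 0, (0 < absz r)%N & phi f0 = (absz r)%:Z] >] = true.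
    by apply/asboolP; exists (f * t1 ^ (- q)); rewrite gE; split=> //; lia.
  by move=> /(_ isT); lia.
pose v f : int := if f == 0 then 0 else (phi f %/ d%:Z)%Z.
have vE f : f != 0 -> v f * d%:Z = phi f by move=> f0; rewrite /v (negPf f0) -phi_dvd.
have v0 : v 0 = 0 by rewrite /v eqxx.
have vM f g : f != 0 -> g != 0 -> v (f * g) = v f + v g.
  move=> f0 g0; have := phiM f g f0 g0.
  by rewrite -!vE // ?mulf_neq0 // -mulrDl => /mulIf; apply; lia.
have vle f g : f != 0 -> g != 0 -> (v f <= v g) = (phi f <= phi g).
  by move=> f0 g0; rewrite -!vE // ler_pM2r //; lia.
have vD f g : f != 0 -> g != 0 -> f + g != 0 -> Num.min (v f) (v g) <= v (f + g).
  by move=> f0 g0 fg0; have := phiD f g f0 g0 fg0; rewrite !ge_min !vle.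
have vC k : k != 0 -> v (iota k) = 0.
  by move=> k0; rewrite /v fmorph_eq0 (negPf k0) phiC // div0z.
have vS : exists f, v f = 1.
  by exists t1; rewrite /v (negPf t10) t1E divzz; lia.
exists (Place v0 vM vD vC vS); split=> /= [f Af|P P0 AP].
  have [->|f0] := eqVneq f 0; first by rewrite v0.
  by move/phi_ge0: Af => /(_ f0); rewrite -vE // pmulr_lge0 //; lia.
by have := phi_pos P P0 AP; rewrite -vE ?ev_eq0 // pmulr_lgt0 //; lia.
Qed.

End Discrete.

(** By degrees, [M] has no inverse in [F[x]]. A subring containing [F[x]] and maximal among those
    omitting the inverse of [M] is a valuation ring, and its place is the one sought. *)
Lemma exists_place_over (M : {poly F}) : (1 < size M)%N ->
  exists Q : place iota, (forall P, 0 <= Q (ev P)) /\ 0 < Q (ev M).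
Proof.
move=> sM; have M0 : M != 0 by rewrite -size_poly_gt0; exact: ltn_trans sM.
have eM0 : ev M != 0 by rewrite ev_eq0.
have [||A [Ar evA AM Amax]] := @exists_maximal_subring K (range ev) (ev M).
- split; first by exists 1; rewrite ?rmorph1.
  + by move=> _ _ [P _ <-] [P' _ <-]; exists (P - P'); rewrite ?rmorphB.
  + by move=> _ _ [P _ <-] [P' _ <-]; exists (P * P'); rewrite ?rmorphM.
- move=> [P _ PE]; have : ev (M * P) = ev 1 by rewrite rmorphM rmorph1 /= PE mulfV.
  move=> /ev_inj MP; have P0 : P != 0.
    by apply/eqP => P0; move/eqP: MP; rewrite P0 mulr0 eq_sym oner_eq0.
  have : size (M * P)%R = 1 by rewrite MP size_poly1.
  have : (0 < size P)%N by rewrite size_poly_gt0.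
  rewrite size_mul //; move: sM; set s1 := size M; set s2 := size P; lia.
have evA' P : A (ev P) by apply: evA; exists P.
have A_val := maximal_subring_valuation Ar (evA' M) eM0 AM Amax.
have [Q [QA QM]] := discrete_place Ar A_val evA' M0 AM.
by exists Q; split=> [P|]; [exact: QA | exact: QM].
Qed.

End PlaceExtension.

(** * Evaluation of polynomials at [x], and of polynomials over [F[x]] at a further element *)

Definition poly_eval (F K : fieldType) (iota : {rmorphism F -> K}) (x : K) :
    {poly F} -> K :=
  horner_morph (fun k => mulrC x (iota k)).

Definition bipoly_eval (R : comNzRingType) (K : fieldType) (ev : {rmorphism R -> K}) (u : K) :
    {poly R} -> K :=
  horner_morph (fun P => mulrC u (ev P)).

HB.instance Definition _ (F K : fieldType) (iota : {rmorphism F -> K}) (x : K) :=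
  GRing.RMorphism.copy (poly_eval iota x) (horner_morph (fun k => mulrC x (iota k))).

HB.instance Definition _ (R : comNzRingType) (K : fieldType) (ev : {rmorphism R -> K}) (u : K) :=
  GRing.RMorphism.copy (bipoly_eval ev u) (horner_morph (fun P => mulrC u (ev P))).

Arguments poly_eval : simpl never.
Arguments bipoly_eval : simpl never.

Section Evaluation.
Variables (F K : fieldType) (iota : {rmorphism F -> K}) (x : K).
Local Notation ev := (poly_eval iota x).

Lemma poly_evalE P : ev P = (map_poly iota P).[x]. Proof. by []. Qed.

Lemma poly_evalC k : ev k%:P = iota k. Proof. exact: horner_morphC. Qed.

Lemma poly_evalX : ev 'X = x. Proof. exact: horner_morphX. Qed.

Lemma poly_eval_inj : ~ algebraicOver iota x -> injective ev.
Proof.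
move=> x_trans; apply: raddf_inj => P Px.
apply: contrapT => /eqP P0; apply: x_trans; exists P => //; exact/eqP.
Qed.

Lemma bipoly_evalE u B : bipoly_eval ev u B = (map_poly ev B).[u]. Proof. by []. Qed.

Lemma bipoly_evalC u P : bipoly_eval ev u P%:P = ev P. Proof. exact: horner_morphC. Qed.

Lemma bipoly_evalX u : bipoly_eval ev u 'X = u. Proof. exact: horner_morphX. Qed.

Lemma bipoly_eval_wide u (B : {poly {poly F}}) k : (size B <= k)%N ->
  bipoly_eval ev u B = \sum_(i < k) ev B`_i * u ^+ i.
Proof.
move=> sB; rewrite bipoly_evalE (horner_coef_wide u (n := k)).
  by apply: eq_bigr => i _; rewrite coef_map.
by apply: leq_trans sB; exact: size_poly.
Qed.

End Evaluation.

(** * Elements of the extension of [F(x)] by a [c]-th root of a polynomial *)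

Section Kummer.
Variables (F K : fieldType) (iota : {rmorphism F -> K}) (x z : K).
Local Notation ev := (poly_eval iota x).
Local Notation E := (bipoly_eval ev).
Hypothesis ev_inj : injective ev.
Variables (c : nat) (D : {poly F}).
Hypothesis c_gt0 : (0 < c)%N.
Hypothesis z_pow : z ^+ c = ev D.
Hypothesis K_gen : forall S : {pred K}, divring_closed S ->
  (forall k : F, iota k \in S) -> x \in S -> z \in S -> forall f : K, f \in S.

Lemma ev_eq0 P : (ev P == 0) = (P == 0).
Proof. by rewrite -(rmorph0 ev) (inj_eq ev_inj). Qed.

Local Notation Phi := ('X^c - D%:P : {poly {poly F}}).

(** The same remainder modulo [Phi] serves every [c]-th root [u] of [ev D]; this uniformity allows
    the passage from [z] to its conjugates. *)
Lemma kummer_reduce B : exists R : {poly {poly F}}, (size R <= c)%N /\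
  forall u, u ^+ c = ev D -> E u B = E u R.
Proof.
have Phi_monic : Phi \is monic by apply: monicXnsubC.
have Phi_size : size Phi = c.+1 by rewrite size_XnsubC.
exists (Pdiv.Ring.rmodp B Phi); split.
  by rewrite -ltnS -Phi_size Pdiv.Ring.ltn_rmodp monic_neq0.
move=> u uc; rewrite {1}(Pdiv.RingMonic.rdivp_eq Phi_monic B) rmorphD rmorphM /=.
by rewrite rmorphB rmorphXn /= bipoly_evalX bipoly_evalC uc subrr mulr0 add0r.
Qed.

(* Multiplication by [E z B] has a matrix over [F[x]] in the generating
   system [1, z, ..., z^(c-1)], so it is a root of its characteristic polynomial. *)
Lemma integral_equation B : exists p : {poly {poly F}},
  [/\ p \is monic, (size p = c.+1)%N & (map_poly ev p).[E z B] = 0].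
Proof.
have /choice [R RP] := fun j : 'I_c => kummer_reduce ('X^j * B).
have RE (j : 'I_c) : E z (R j) = z ^+ j * E z B.
  by have [_ /(_ _ z_pow) <-] := RP j; rewrite rmorphM rmorphXn /= bipoly_evalX.
pose A : 'M[{poly F}]_c := \matrix_(i, j) (R j)`_i.
pose v : 'rV[K]_c := \row_i z ^+ i.
exists (char_poly A); split; [exact: char_poly_monic | exact: size_char_poly |].
apply/eqP; rewrite -/(root _ _) map_char_poly -eigenvalue_root_char.
apply/eigenvalueP; exists v.
  apply/rowP => j; rewrite !mxE [RHS]mulrC -RE (bipoly_eval_wide _ _ _ (RP j).1).
  by apply: eq_bigr => i _; rewrite !mxE mulrC.
apply/negP => /eqP/rowP/(_ (Ordinal c_gt0)); rewrite !mxE expr0.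
by apply/eqP; exact: oner_neq0.
Qed.

Definition kummer_fraction f := exists (B : {poly {poly F}}) (M : {poly F}), M != 0 /\ f = E z B / ev M.

(** After cancelling factors ['X], the integral equation of [E z B] has a nonzero constant
    coefficient. Dividing by that coefficient writes the inverse of [E z B] as a polynomial in
    [E z B] over a polynomial in [x]. *)
Lemma kummer_fraction_inv f : kummer_fraction f -> kummer_fraction f^-1.
Proof.
move=> [B [M [M0 fE]]].
have ratio g P : P != 0 -> kummer_fraction g -> kummer_fraction (g / ev P).
  move=> P0 [B' [M' [M'0 ->]]]; exists B', (M' * P); split; first exact: mulf_neq0.
  by rewrite rmorphM /= invfM mulrA.
have mul P g : kummer_fraction g -> kummer_fraction (g * ev P).
  move=> [B' [M' [M'0 ->]]]; exists (B' * P%:P), M'; split=> //.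
  by rewrite rmorphM /= bipoly_evalC mulrAC.
have [->|f0] := eqVneq f 0.
  by rewrite invr0; exists 0, 1; rewrite oner_neq0 rmorph0 mul0r.
have eM0 : ev M != 0 by rewrite ev_eq0.
have B0 : E z B != 0 by apply: contra_neq f0 => B0; rewrite fE B0 mul0r.
rewrite fE invf_div mulrC; apply: mul.
have [p [p_monic _ pB]] := integral_equation B.
move: (monic_neq0 p_monic) pB; elim/poly_ind: {p_monic} p => [|p P IH]; first by rewrite eqxx.
have [->|P0] := eqVneq P 0.
  rewrite addr0 mulf_eq0 polyX_eq0 orbF => p0.
  rewrite rmorphM /= map_polyX hornerM hornerX => /eqP.
  by rewrite mulf_eq0 (negPf B0) orbF => /eqP; exact: IH.
move=> _; rewrite rmorphD rmorphM /= map_polyX map_polyC /= hornerD hornerM hornerX hornerC => pB.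
have -> : (E z B)^-1 = - (map_poly ev p).[E z B] / ev P.
  have eP0 : ev P != 0 by rewrite ev_eq0.
  apply: (mulfI B0); rewrite mulfV // mulrA mulrN mulrC.
  apply: (mulfI eP0); rewrite mulVKf // mulr1; apply/eqP.
  by rewrite -subr_eq0 opprK addrC mulrC pB.
apply: ratio => //; exists (- \sum_(i < size p) (p`_i)%:P * B ^+ i), 1.
rewrite oner_neq0 rmorph1 divr1; split=> //.
rewrite rmorphN rmorph_sum /=; congr (- _).
rewrite (horner_coef_wide (n := size p)) ?size_poly //; apply: eq_bigr => i _.
by rewrite rmorphM rmorphXn /= bipoly_evalC coef_map.
Qed.

(** The fractions form a field containing the constants, [x] and [z], so [K_gen] applies. *)
Lemma kummer_fractionP f : kummer_fraction f.
Proof.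
pose S := [pred g | `[< kummer_fraction g >]].
suff : f \in S by move/asboolP.
apply: K_gen => [|k||].
- split.
  + by apply/asboolP; exists 1, 1; rewrite oner_neq0 !rmorph1 divr1.
  + move=> g g' /asboolP [B [M [M0 ->]]] /asboolP [B' [M' [M'0 ->]]]; apply/asboolP.
    exists (B * M'%:P - B' * M%:P), (M * M'); split; first exact: mulf_neq0.
    rewrite rmorphB !rmorphM /= !bipoly_evalC.
    by field_nz; rewrite ev_eq0.
  + move=> g g' /asboolP [B [M [M0 ->]]] /asboolP /kummer_fraction_inv.
    move=> [B' [M' [M'0 ->]]]; apply/asboolP.
    exists (B * B'), (M * M'); split; first exact: mulf_neq0.
    by rewrite !rmorphM /= mulf_div.
- by apply/asboolP; exists k%:P%:P, 1; rewrite oner_neq0 rmorph1 divr1 bipoly_evalC poly_evalC.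
- by apply/asboolP; exists 'X%:P, 1; rewrite oner_neq0 rmorph1 divr1 bipoly_evalC poly_evalX.
- by apply/asboolP; exists 'X, 1; rewrite oner_neq0 rmorph1 divr1 bipoly_evalX.
Qed.

Lemma kummer_repr f : exists (B : {poly {poly F}}) (M : {poly F}), [/\ M != 0, (size B <= c)%N & f = E z B / ev M].
Proof.
have [B [M [M0 ->]]] := kummer_fractionP f; have [R [sR RE]] := kummer_reduce B.
by exists R, M; rewrite RE.
Qed.

Lemma kummer_algebraic f : exists p : {poly {poly F}},
  [/\ p != 0, (size p <= c.+1)%N & (map_poly ev p).[f] = 0].
Proof.
have [B [M [M0 fE]]] := kummer_fractionP f.
have [p [p_monic sp pB]] := integral_equation B.
(* Scaling the coefficient of degree [i] by [M ^+ i] turns an equation of [f * ev M] into one of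
   [f]. *)
exists (\poly_(i < c.+1) (p`_i * M ^+ i)); split; last 1 first.
- rewrite -pB [in RHS](horner_coef_wide (n := c.+1)); last by rewrite -sp size_poly.
  rewrite (horner_coef_wide (n := c.+1)); last first.
    by apply: leq_trans (size_poly _ _) _; exact: size_poly.
  apply: eq_bigr => i _; rewrite !coef_map coef_poly ltn_ord /= rmorphM rmorphXn /=.
  by rewrite fE expr_div_n; field; rewrite expf_neq0 // ev_eq0.
- apply/eqP => /polyP/(_ c); rewrite coef_poly ltnSn coef0 => /eqP.
  have -> : p`_c = 1 by rewrite -(monicP p_monic) lead_coefE sp.
  by rewrite mul1r expf_eq0 (negPf M0) andbF.
- exact: size_poly.
Qed.

End Kummer.

(** * Totally ramified places and Galois conjugation in the Kummer extension *)

Section KummerPlaces.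
Variables (F K : fieldType) (iota : {rmorphism F -> K}) (x z : K).
Local Notation ev := (poly_eval iota x).
Local Notation E := (bipoly_eval ev).
Hypothesis ev_inj : injective ev.
Variables (c : nat) (D : {poly F}).
Hypothesis c_gt0 : (0 < c)%N.
Hypothesis z_pow : z ^+ c = ev D.
Hypothesis D_neq0 : D != 0.
Hypothesis K_gen : forall S : {pred K}, divring_closed S ->
  (forall k : F, iota k \in S) -> x \in S -> z \in S -> forall f : K, f \in S.

Lemma kummer_gen_neq0 : z != 0.
Proof.
by apply: contra_neq D_neq0 => z0; apply: ev_inj; rewrite -z_pow z0 rmorph0 expr0n gtn_eqF.
Qed.

Lemma kummer_term_eq0 l P : (z ^+ l * ev P == 0) = (P == 0).
Proof. by rewrite mulf_eq0 expf_eq0 (negPf kummer_gen_neq0) andbF (ev_eq0 ev_inj). Qed.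

(** This expresses total ramification at [Q] through values: the exponent of [z] can be read off
    from the value of a term, so the terms of a reduced polynomial in [z] cannot cancel at [Q]. *)
Definition separates (Q : place iota) := forall l l' (P P' : {poly F}),
  (l < c)%N -> (l' < c)%N -> P != 0 -> P' != 0 ->
  Q (z ^+ l * ev P) = Q (z ^+ l' * ev P') -> l = l'.

Lemma separates_min (Q : place iota) (B : {poly {poly F}}) :
    separates Q -> B != 0 -> (size B <= c)%N ->
  E z B != 0 /\ exists l, [/\ (l < c)%N, B`_l != 0, Q (E z B) = Q (z ^+ l * ev B`_l) &
    forall l', B`_l' != 0 -> Q (z ^+ l * ev B`_l) <= Q (z ^+ l' * ev B`_l')].
Proof.
move=> sepQ B0 sB; rewrite (bipoly_eval_wide _ _ _ sB).
under eq_bigr => i _ do rewrite mulrC.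
pose t (i : 'I_c) := z ^+ i * ev B`_i.
have [||i [ti s0 sE min_i]] := @pval_sum_distinct _ _ _ Q c t.
- move=> i j; rewrite !kummer_term_eq0 => Bi Bj /sepQ eq_ij.
  by apply: val_inj; exact: eq_ij.
- have slt : ((size B).-1 < c)%N by rewrite prednK // size_poly_gt0.
  by exists (Ordinal slt); rewrite kummer_term_eq0 -lead_coefE lead_coef_eq0.
split=> //; exists i; split=> //; first by rewrite -(kummer_term_eq0 i).
move=> l' Bl'; have lt_l' : (l' < c)%N.
  by apply: leq_trans sB; rewrite ltnNge; apply: contra Bl' => /(nth_default _) ->.
by apply: (min_i (Ordinal lt_l')); rewrite kummer_term_eq0.
Qed.

Lemma place_scale (Q : place iota) (w : int) : 0 < w ->
  (forall f, f != 0 -> exists mu, Q f = w * mu) -> w = 1.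
Proof.
move=> w0 Qw; have [t Qt] := pval_surj Q.
have [|mu] := Qw t; first by apply/eqP => t0; move: Qt; rewrite t0 pval0.
rewrite Qt => /esym wmu; have mu0 : 0 < mu by rewrite -(pmulr_rgt0 _ w0) wmu.
have : w <= w * mu by rewrite ler_peMr //; lia.
by rewrite wmu; lia.
Qed.

(** Every function is a reduced polynomial in [z] over a polynomial in [x], and at both places the
    numerator has the least value of its terms. So the proportionality extends from terms to all of
    [K], and the normalization of places forces [w = w' = 1]. *)
Lemma separates_eq (Q Q' : place iota) (w w' : int) :
    separates Q -> separates Q' -> 0 < w -> 0 < w' ->
    (forall l P, P != 0 -> exists mu : int,
      Q (z ^+ l * ev P) = w * mu /\ Q' (z ^+ l * ev P) = w' * mu) ->
  w = 1 /\ Q = Q'.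
Proof.
move=> sepQ sepQ' w0 w0' mono.
have val f : f != 0 -> exists mu : int, Q f = w * mu /\ Q' f = w' * mu.
  have [B [M [M0 sB ->]]] := kummer_repr ev_inj c_gt0 z_pow K_gen f => f0.
  have B0 : B != 0 by apply: contra_neq f0 => ->; rewrite rmorph0 mul0r.
  have [EB0 [l [_ Bl QB min_l]]] := separates_min sepQ B0 sB.
  have [_ [l' [_ Bl' QB' min_l']]] := separates_min sepQ' B0 sB.
  have eM0 : ev M != 0 by rewrite ev_eq0.
  have [mu [Qmu Qmu']] := mono l _ Bl; have [nu [Qnu Qnu']] := mono l' _ Bl'.
  have [mM [QM QM']] := mono 0%N _ M0; rewrite expr0 mul1r in QM QM'.
  have := min_l _ Bl'; have := min_l' _ Bl.
  rewrite Qmu Qnu Qmu' Qnu' !ler_pM2l // => le1 le2.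
  have eq_mu : mu = nu by apply: le_anti; rewrite le1 le2.
  exists (mu - mM); rewrite !pval_div // QB QB' QM QM' Qmu Qnu' eq_mu.
  by split; ring.
have w1 : w = 1 by apply: (place_scale (Q := Q)) => // f /val [mu [? _]]; exists mu.
have w1' : w' = 1 by apply: (place_scale (Q := Q')) => // f /val [mu [_ ?]]; exists mu.
by split=> //; apply: place_eq => f /val [mu [-> ->]]; rewrite w1 w1'.
Qed.

Section Twist.
Variable Q0 : place iota.
Hypothesis sepQ0 : separates Q0.

(** A separating place shows that 1, [z], ..., [z ^+ (c - 1)] are independent over [F(x)]. So the
    remainder of [B] modulo [Phi] is zero, and [B] vanishes at every conjugate too. *)
Lemma kummer_conj_eq0 B u : u ^+ c = ev D -> E z B = 0 -> E u B = 0.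
Proof.
move=> uc; have [R [sR RE]] := kummer_reduce iota x D c_gt0 B.
rewrite !RE // => R0; have [->|Rn0] := eqVneq R 0; first by rewrite rmorph0.
by have [/eqP] := separates_min sepQ0 Rn0 sR.
Qed.

Lemma kummer_conj_eq B B' M M' u : u ^+ c = ev D -> M != 0 -> M' != 0 ->
  E z B / ev M = E z B' / ev M' -> E u B / ev M = E u B' / ev M'.
Proof.
move=> uc M0 M'0 /eqP; rewrite eqr_div ?(ev_eq0 ev_inj) // => /eqP eqz.
apply/eqP; rewrite eqr_div ?(ev_eq0 ev_inj) // -subr_eq0; apply/eqP.
have := @kummer_conj_eq0 (B * M'%:P - B' * M%:P) u uc.
by rewrite !rmorphB !rmorphM /= !bipoly_evalC; apply; rewrite eqz subrr.
Qed.

(** The place [Q'] is [Q] composed with the automorphism over [F(x)] that sends [z] to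
    [iota xi * z]; [kummer_conj_eq] makes this map independent of the chosen fraction. *)
Lemma exists_conj_place (Q : place iota) (xi : F) : xi ^+ c = 1 ->
  exists Q' : place iota, forall B M, M != 0 ->
    Q' (E z B / ev M) = Q (E (iota xi * z) B / ev M).
Proof.
move=> xic; set u := iota xi * z.
have uc : u ^+ c = ev D by rewrite exprMn -rmorphXn xic rmorph1 mul1r.
have exs f : exists g, forall B M, M != 0 -> f = E z B / ev M -> g = E u B / ev M.
  have [B [M [M0 _ ->]]] := kummer_repr ev_inj c_gt0 z_pow K_gen f.
  by exists (E u B / ev M) => B' M' M'0; exact: kummer_conj_eq.
have /choice [s sP] := exs.
have sE B M : M != 0 -> s (E z B / ev M) = E u B / ev M by move=> M0; exact: sP.
have repr := kummer_repr ev_inj c_gt0 z_pow K_gen.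
have sM f g : s (f * g) = s f * s g.
  have [B [M [M0 _ ->]]] := repr f; have [B' [M' [M'0 _ ->]]] := repr g.
  by rewrite mulf_div -!rmorphM !sE ?mulf_neq0 // !rmorphM /= mulf_div.
have sD f g : s (f + g) = s f + s g.
  have [B [M [M0 _ ->]]] := repr f; have [B' [M' [M'0 _ ->]]] := repr g.
  have addE v : E v B / ev M + E v B' / ev M' = E v (B * M'%:P + B' * M%:P) / ev (M * M').
    rewrite rmorphD !rmorphM /= !bipoly_evalC.
    by field_nz; rewrite (ev_eq0 ev_inj).
  by rewrite addE !sE ?mulf_neq0 // addE.
have siota k : s (iota k) = iota k.
  have := @sE k%:P%:P 1 (oner_neq0 _).
  by rewrite rmorph1 !divr1 !bipoly_evalC poly_evalC.
have s1 : s 1 = 1 by rewrite -(rmorph1 iota) siota.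
have s0 : s 0 = 0 by rewrite -(rmorph0 iota) siota.
have s_neq0 f : f != 0 -> s f != 0.
  move=> f0; apply/eqP => sf.
  by have /eqP := sM f f^-1; rewrite mulfV // s1 sf mul0r oner_eq0.
have v0 : Q (s 0) = 0 by rewrite s0 pval0.
have vM f g : f != 0 -> g != 0 -> Q (s (f * g)) = Q (s f) + Q (s g).
  by move=> f0 g0; rewrite sM pvalM // s_neq0.
have vD f g : f != 0 -> g != 0 -> f + g != 0 ->
    Num.min (Q (s f)) (Q (s g)) <= Q (s (f + g)).
  by move=> f0 g0 fg0; rewrite sD pvalD // -?sD s_neq0.
have vC k : k != 0 -> Q (s (iota k)) = 0 by move=> k0; rewrite siota pvalC.
have xi0 : xi != 0.
  by apply/eqP => xi0; move: xic; rewrite xi0 expr0n gtn_eqF // => /eqP; rewrite eq_sym oner_eq0.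
(* The preimage of an element of value 1 comes from the inverse automorphism, which multiplies [z]
   by the inverse of [xi]. *)
have vS : exists t, Q (s t) = 1.
  have [t Qt] := pval_surj Q; have [B [M [M0 _ tE]]] := repr t.
  exists (E (iota xi^-1 * z) B / ev M); rewrite -Qt tE.
  pose B' := \sum_(i < size B) (B`_i * (xi^-1 ^+ i)%:P)%:P * 'X^i : {poly {poly F}}.
  have B'E v : E v B' = E (iota xi^-1 * v) B.
    rewrite (bipoly_eval_wide _ _ _ (leqnn (size B))) /B' rmorph_sum; apply: eq_bigr => i _.
    rewrite rmorphM /= bipoly_evalC rmorphM /= poly_evalC !rmorphXn /= bipoly_evalX.
    by rewrite exprMn mulrA.
  by rewrite -B'E sE // B'E /u mulrA -rmorphM mulVf // rmorph1 mul1r.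
by exists (Place v0 vM vD vC vS) => B M M0 /=; rewrite sE.
Qed.

(** Orthogonality of the characters of the cyclic Galois group isolates the component of degree [l]:
    the inner sum over [j] is a geometric sum of roots of unity, which vanishes unless [i = l]. *)
Lemma kummer_component xi (B : {poly {poly F}}) l : c.-primitive_root xi -> (c%:R != 0 :> F) ->
    (size B <= c)%N -> (l < c)%N ->
  z ^+ l * ev B`_l = iota c%:R^-1 *
    \sum_(j < c) iota (xi ^- (j * l)) * E (iota (xi ^+ j) * z) B.
Proof.
move=> xi_prim c0 sB lt_l.
have xi0 : xi != 0.
  apply/eqP => xi0; have := prim_expr_order xi_prim.
  by rewrite xi0 expr0n gtn_eqF // => /eqP; rewrite eq_sym oner_eq0.
have -> : \sum_(j < c) iota (xi ^- (j * l)) * E (iota (xi ^+ j) * z) B =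
    \sum_(i < c) ev B`_i * z ^+ i * iota (\sum_(j < c) (xi ^+ i / xi ^+ l) ^+ j).
  under eq_bigr => j _ do rewrite (bipoly_eval_wide _ _ _ sB) mulr_sumr.
  rewrite exchange_big /=; apply: eq_bigr => i _.
  rewrite rmorph_sum mulr_sumr; apply: eq_bigr => j _ /=.
  rewrite exprMn -rmorphXn mulrCA -!mulrA; congr (_ * _).
  rewrite mulrA -rmorphM [RHS]mulrC; congr (iota _ * _).
  by rewrite expr_div_n -!exprM mulrC (mulnC l) (mulnC i).
rewrite (bigD1 (Ordinal lt_l)) //= [X in _ + X]big1 ?addr0 => [|i il]; last first.
  rewrite -[X in iota X](mulKf (x := xi ^+ i / xi ^+ l - 1)).
    rewrite -subrX1 expr_div_n -!exprM ![(_ * c)%N]mulnC !exprM.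
    by rewrite (prim_expr_order xi_prim) !expr1n divr1 subrr mulr0 rmorph0 mulr0.
  rewrite subr_eq0; apply: contra il => /eqP eq1.
  have /eqP : xi ^+ i = xi ^+ l by rewrite -[LHS](divfK (expf_neq0 l xi0)) eq1 mul1r.
  by rewrite (eq_prim_root_expr xi_prim) !modn_small.
rewrite mulfV ?expf_neq0 // (eq_bigr (fun=> 1)) => [|j _]; last by rewrite expr1n.
by rewrite sumr_const card_ord [RHS]mulrCA -rmorphM mulVf // rmorph1 mulr1 mulrC.
Qed.

(** Conjugation preserves values on [F[x]], hence preserves [G]. So all conjugates of the function
    are regular on [G], and by [kummer_component] each component is a linear combination of them
    over the constants. *)
Lemma component_nneg (xi : F) (G : place iota -> Prop) (B : {poly {poly F}}) M :
    c.-primitive_root xi -> (c%:R != 0 :> F) ->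
    (forall Q Q' : place iota, (forall P, Q' (ev P) = Q (ev P)) -> G Q -> G Q') ->
    (size B <= c)%N -> M != 0 -> (forall Q, G Q -> 0 <= Q (E z B / ev M)) ->
  forall Q l, G Q -> (l < c)%N -> 0 <= Q (z ^+ l * ev B`_l / ev M).
Proof.
move=> xi_prim c0 Ginv sB M0 nneg Q l GQ lt_l.
have nnegM (k : F) f : k != 0 -> 0 <= Q f -> 0 <= Q (iota k * f).
  move=> k0 Qf; have [->|f0] := eqVneq f 0; first by rewrite mulr0 pval0.
  by rewrite pvalM ?fmorph_eq0 // pvalC // add0r.
have xi0 : xi != 0.
  apply/eqP => xi0; have := prim_expr_order xi_prim.
  by rewrite xi0 expr0n gtn_eqF // => /eqP; rewrite eq_sym oner_eq0.
rewrite (kummer_component xi_prim c0 sB lt_l) -mulrA; apply: (nnegM); first by rewrite invr_eq0.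
rewrite mulr_suml; apply: pval_nneg_sum => j _.
rewrite -mulrA; apply: (nnegM); first by rewrite invr_eq0 expf_neq0.
have [|Q' Q'E] := @exists_conj_place Q (xi ^+ j).
  by rewrite -exprM mulnC exprM (prim_expr_order xi_prim) expr1n.
rewrite -Q'E //; apply: nneg; apply: Ginv GQ => P.
by have := Q'E P%:P 1 (oner_neq0 _); rewrite !bipoly_evalC rmorph1 !divr1.
Qed.

End Twist.
End KummerPlaces.

(** * Arithmetic of the polynomials [X^n + X] and [h] over the finite field *)

Lemma GK_degreeE (n : nat) : (2 <= n)%N -> ((n ^ 2 - n + 1) * n.+1 = n ^ 3 + 1)%N.
Proof.
move=> n_ge2; have [d dE] : exists d, (n ^ 2 = d + n)%N.
  by exists (n ^ 2 - n)%N; rewrite subnK // expnS leq_pmulr //; lia.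
by rewrite (expnSr n 2) dE addnK; move: dE; rewrite !expnS expn0; nia.
Qed.

Section GKPolynomials.
Variables (n : nat) (F : finFieldType).
Hypotheses (n_ge2 : (2 <= n)%N) (n_pp : prime_power n) (cardF : #|F| = (n ^ 6)%N).

Local Notation A := (n ^ 2 - n + 1)%N.
Local Notation W := ('X^n + 'X : {poly F}).
Local Notation h := (GK_h n 'X : {poly F}).

Lemma natr_GK0 : n%:R = 0 :> F.
Proof.
(* The shift by 1 permutes [F], so it preserves the sum of all elements, while adding 1 once for
   each of them. *)
have : (#|F|)%:R = 0 :> F.
  apply: (addrI (\sum_(u : F) u)); rewrite addr0 {2}(reindex_inj (addIr 1)) /=.
  by rewrite big_split /= sumr_const.
by rewrite cardF natrX => /eqP; rewrite expf_eq0 /= => /eqP.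
Qed.

Lemma GK_frobenius (u v : {poly F}) : (u + v) ^+ n = u ^+ n + v ^+ n.
Proof.
have [p [e [p_pr e0 nE]]] := n_pp.
have pchar_p : p \in [pchar {poly F}].
  rewrite inE p_pr -polyC_natr; apply/eqP; rewrite -[RHS]polyC0; congr _%:P.
  by have := natr_GK0; rewrite nE natrX => /eqP; rewrite expf_eq0 e0 /= => /eqP.
by apply: exprDn_pchar; rewrite nE pnatX pnatE // pchar_p.
Qed.

(** Expanding [(1 - 1) ^+ n] by Frobenius treats odd and even [n] together. *)
Lemma GK_sign : (-1) ^+ n = -1 :> {poly F}.
Proof.
have := GK_frobenius 1 (-1); rewrite subrr expr0n expr1n gtn_eqF; last exact: ltnW.
by move=> /esym/eqP; rewrite addrC addr_eq0 => /eqP.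
Qed.

(** With [t = 'X^(n - 1)], the polynomial [- h] is the geometric sum of the powers of [- t], and
    [W = 'X * (1 + t)], so the product telescopes. *)
Lemma GK_h_mul : h * W = 'X^(n ^ 2) - 'X.
Proof.
pose t : {poly F} := 'X^(n - 1).
have hE : h = - \sum_(i < n.+1) (- t) ^+ i.
  rewrite -sumrN; apply: eq_bigr => i _.
  by rewrite exprS mulN1r mulNr [(- t) ^+ i]exprNn -exprM mulnC.
have WE : W = 'X * (1 + t).
  have nE : n = (n - 1).+1 by lia.
  by rewrite mulrDr mulr1 {1}nE exprS addrC.
have tE : (- t) ^+ n.+1 = t ^+ n.+1 by rewrite exprNn exprS GK_sign mulrN1 opprK mul1r.
have : (- t) ^+ n.+1 - 1 = (- t - 1) * \sum_(i < n.+1) (- t) ^+ i by rewrite subrX1.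
rewrite tE => geom.
have -> : h * W = 'X * (t ^+ n.+1 - 1) by rewrite geom hE WE; ring.
have nE : (n ^ 2 = ((n - 1) * n.+1).+1)%N by rewrite expnS expn1; nia.
by rewrite mulrBr mulr1 nE ['X^(_.+1)]exprS exprM.
Qed.

(** Since [n = 0] in [F], the derivative of the product is -1. *)
Lemma GK_separable : separable_poly (h * W).
Proof.
rewrite GK_h_mul separable_poly.unlock derivB derivXn derivX.
have -> : ('X^((n ^ 2).-1) : {poly F}) *+ (n ^ 2) = 0.
  by rewrite -mulr_natr -polyC_natr natrX natr_GK0 expr0n mulr0.
by apply/Bezout_eq1_coprimepP; exists (0, -1); rewrite mul0r !add0r mulrNN mulr1.
Qed.

Lemma GK_W_neq0 : W != 0.
Proof.
by have := separable_poly_neq0 GK_separable; rewrite mulf_eq0 => /norP [].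
Qed.

Lemma GK_h_neq0 : h != 0.
Proof.
by have := separable_poly_neq0 GK_separable; rewrite mulf_eq0 => /norP [].
Qed.

Lemma GK_coprime : coprimep h W.
Proof. exact: separable_coprime GK_separable (dvdpp _). Qed.

Lemma GK_h_coprime (G H : {poly F}) : h = G * H -> coprimep G H.
Proof.
by move=> hE; apply: separable_coprime GK_separable _; rewrite -hE dvdp_mulr.
Qed.

Lemma GK_W_factor a : root W a -> exists2 R, W = R * ('X - a%:P) & ~~ root R a.
Proof.
move=> /factor_theorem [R WE]; exists R => //; rewrite -coprimep_XsubC.
by apply: separable_coprime GK_separable _; rewrite -WE dvdp_mull.
Qed.

Lemma GK_size_W : size W = n.+1.
Proof. by rewrite size_polyDl size_polyXn // size_polyX ltnS. Qed.

Lemma GK_W_prod (a : 'I_n -> F) : injective a -> (forall j, root W (a j)) ->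
  W = \prod_j ('X - (a j)%:P).
Proof.
move=> a_inj a_root.
have lead_W : lead_coef W = 1.
  by rewrite lead_coefDl ?lead_coefXn // size_polyXn size_polyX ltnS.
rewrite [LHS](@all_roots_prod_XsubC _ W (codom a)).
- by rewrite lead_W scale1r big_map big_enum.
- by rewrite size_codom card_ord GK_size_W.
- by apply/allP => _ /codomP [j ->].
- by rewrite uniq_rootsE map_inj_uniq ?enum_uniq.
Qed.

Lemma GK_size_h : size h = A.
Proof.
have := congr1 (size \o @polyseq F) GK_h_mul.
rewrite /= size_mul ?GK_W_neq0 ?GK_h_neq0 // GK_size_W size_polyDl ?size_polyN.
  rewrite size_polyXn; have : (n <= n ^ 2)%N by rewrite expnS leq_pmulr //; lia.
  by set s1 := size h; lia.
by rewrite size_polyXn size_polyX ltnS expnS expn1; nia.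
Qed.

(** The order of the cyclic group of units is [n^6 - 1 = (n^3 + 1) (n^3 - 1)], so a power of a
    generator has the required order. *)
Lemma GK_primitive_root : exists xi : F, (n ^ 3 + 1).-primitive_root xi.
Proof.
have n3 : (8 <= n ^ 3)%N by rewrite -[8%N]/(2 ^ 3)%N leq_exp2r.
have cardE : (#|F|.-1 = (n ^ 3 + 1) * (n ^ 3 - 1))%N.
  by rewrite cardF -[6%N]/(3 + 3)%N expnD; nia.
pose rs := [seq u <- enum F | u != 0].
have rsE u : (u \in rs) = (u != 0) by rewrite mem_filter mem_enum andbT.
have Urs : uniq rs by apply: filter_uniq; exact: enum_uniq.
have srs : (size rs = #|F|.-1)%N.
  transitivity #|predC1 (0 : F)|; last exact: cardC1.
  by rewrite -(card_uniqP Urs); apply: eq_card => u; rewrite rsE inE.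
have /hasP [g _ g_prim] : has #|F|.-1.-primitive_root rs.
  apply: has_prim_root => //; rewrite ?srs //; first by rewrite cardE; nia.
  apply/allP => u; rewrite rsE => u0; apply/unity_rootP; apply: (mulfI u0).
  by rewrite -exprS prednK ?expf_card ?mulr1 // cardF expn_gt0; lia.
exists (g ^+ (n ^ 3 - 1)).
have := dvdn_prim_root g_prim (_ : n ^ 3 + 1 %| #|F|.-1)%N.
by rewrite cardE mulKn ?addn1 //; apply; rewrite dvdn_mulr.
Qed.

End GKPolynomials.

(** * Values of polynomials in [x] *)

Section PolynomialValues.
Variables (F K : fieldType) (iota : {rmorphism F -> K}) (x : K).
Local Notation ev := (poly_eval iota x).
Hypothesis ev_inj : injective ev.
Implicit Types (Q : place iota) (P N : {poly F}).

Lemma pval_iota_nneg Q k : 0 <= Q (iota k).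
Proof. by have [->|k0] := eqVneq k 0; rewrite ?rmorph0 ?pval0 ?pvalC. Qed.

Lemma pval_ev_nneg Q P : 0 <= Q x -> 0 <= Q (ev P).
Proof.
move=> Qx; have nnegM f g : 0 <= Q f -> 0 <= Q g -> 0 <= Q (f * g).
  move=> Qf Qg; have [->|f0] := eqVneq f 0; first by rewrite mul0r pval0.
  have [->|g0] := eqVneq g 0; first by rewrite mulr0 pval0.
  by rewrite pvalM // addr_ge0.
rewrite poly_evalE horner_coef; apply: pval_nneg_sum => i _.
by apply: nnegM; rewrite ?coef_map ?pval_iota_nneg // pvalX mulr_ge0.
Qed.

Lemma pval_ev_coprime Q P N : 0 <= Q x -> coprimep P N -> 0 < Q (ev N) -> Q (ev P) = 0.
Proof.
move=> Qx /Bezout_eq1_coprimepP [[u v] /= uv] QN.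
apply/eqP; rewrite eq_le pval_ev_nneg // andbT leNgt; apply/negP => QP.
have pos w V : 0 < Q (ev V) -> vge Q 1 (ev (w * V)).
  move=> QV; have [->|w0] := eqVneq w 0; first by left; rewrite mul0r rmorph0.
  have V0 : V != 0 by apply/eqP => V0; rewrite V0 rmorph0 pval0 ltxx in QV.
  right; rewrite rmorphM pvalM ?(ev_eq0 ev_inj) //.
  by have := pval_ev_nneg w Qx; move: QV; set s := Q (ev V); set t := Q (ev w); lia.
have := vgeD (pos u _ QP) (pos v _ QN); rewrite -rmorphD uv rmorph1 => -[/eqP|].
  by rewrite oner_eq0.
by rewrite pval1.
Qed.

Lemma pval_root_nneg Q a : 0 < Q (x - iota a) -> 0 <= Q x.
Proof.
move=> Qa; rewrite -(subrK (iota a) x).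
have [||->|//] := @vgeD _ _ _ Q 0 (x - iota a) (iota a); last by rewrite pval0.
  by right; exact: ltW.
by right; exact: pval_iota_nneg.
Qed.

(** The number [m] is the multiplicity of the root [a], the same for all places over [a], which lets
    [separates_eq] compare two of them. The cofactor is coprime to [X - a] and has value 0. *)
Lemma pval_ev_root a P : P != 0 -> exists m : nat, forall Q : place iota,
  0 < Q (x - iota a) -> Q (ev P) = m%:Z * Q (x - iota a).
Proof.
move=> P0; have [m [N]] := multiplicity_XsubC P a; rewrite P0 /= => Na PE.
have evXa : ev ('X - a%:P) = x - iota a by rewrite rmorphB /= poly_evalX poly_evalC.
have N0 : N != 0 by apply: contraNneq Na => ->; rewrite root0.
exists m => Q Qa; rewrite PE rmorphM rmorphXn /= pvalM ?(ev_eq0 ev_inj) //; last first.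
  by rewrite expf_neq0 // ev_eq0 // polyXsubC_eq0.
rewrite pvalX evXa (@pval_ev_coprime _ _ ('X - a%:P)) ?add0r ?evXa ?coprimep_XsubC //.
exact: pval_root_nneg Qa.
Qed.

Lemma pval_ev_infty Q P : Q x < 0 -> P != 0 -> Q (ev P) = (size P).-1%:Z * Q x.
Proof.
move=> Qx; elim/poly_ind: P => [|P k IH]; first by rewrite eqxx.
have x0 : x != 0 by apply: contraTneq Qx => ->; rewrite pval0 ltxx.
have [->|P0] := eqVneq P 0.
  rewrite mul0r add0r polyC_eq0 => k0.
  by rewrite poly_evalC pvalC // size_polyC k0 mul0r.
move=> _; rewrite rmorphD rmorphM /= poly_evalX poly_evalC size_MXaddC (negPf P0) /=.
have QP : Q (ev P * x) = (size P)%:Z * Q x.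
  rewrite pvalM ?ev_eq0 // IH //.
  have : (0 < size P)%N by rewrite size_poly_gt0.
  by case: (size P) => // s _ /=; rewrite -addn1 PoszD; ring.
have [||_ ->] := @pvalD_lt _ _ _ Q (ev P * x) (iota k) => //.
  by rewrite mulf_neq0 ?ev_eq0.
right; have := pval_iota_nneg Q k; rewrite QP.
have : (0 < size P)%N by rewrite size_poly_gt0.
by move: Qx; set s := Q x; set t := Q (iota k); nia.
Qed.

End PolynomialValues.

(** * Places of the curve at infinity and over the roots of [X^n + X] *)

Lemma congr_lt_eq (c l l' : nat) (k : int) :
  (l < c)%N -> (l' < c)%N -> l'%:Z - l%:Z = c%:Z * k -> l = l'.
Proof.
move=> lt_l lt_l' E; have [k0|[k0|k0]] : k = 0 \/ 1 <= k \/ k <= -1 by lia.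
- by move: E; rewrite k0; lia.
- have : c%:Z <= c%:Z * k by rewrite ler_peMr.
  by rewrite -E; lia.
- have : c%:Z * k <= c%:Z * -1 by rewrite ler_wpM2l.
  by rewrite -E; lia.
Qed.

Section GKPlaces.
Variables (n : nat) (F : finFieldType).
Hypotheses (n_ge2 : (2 <= n)%N) (n_pp : prime_power n) (cardF : #|F| = (n ^ 6)%N).
Variables (K : fieldType) (iota : {rmorphism F -> K}) (x y z : K).
Hypothesis KGK : GK_function_field n iota x y z.

Local Notation ev := (poly_eval iota x).
Local Notation A := (n ^ 2 - n + 1)%N.
Local Notation c := (n ^ 3 + 1)%N.
Local Notation W := ('X^n + 'X : {poly F}).
Local Notation h := (GK_h n 'X : {poly F}).
Implicit Types Q : place iota.

Lemma GK_ev_inj : injective ev.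
Proof. by have [x_trans _ _] := KGK; exact: poly_eval_inj. Qed.

Local Notation ev_eq0 := (ev_eq0 GK_ev_inj).

Lemma GK_ev_h : ev h = GK_h n x.
Proof.
rewrite rmorph_sum; apply: eq_bigr => i _.
by rewrite rmorphM !rmorphXn rmorphN1 /= poly_evalX.
Qed.

Lemma GK_z_pow : z ^+ A = y * ev h.
Proof. by rewrite GK_ev_h; have [_ [-> _] _] := KGK. Qed.

Lemma GK_y_pow : y ^+ n.+1 = ev W.
Proof. by rewrite rmorphD rmorphXn /= poly_evalX; have [_ [_ <-] _] := KGK. Qed.

Definition GK_disc : {poly F} := W * h ^+ n.+1.

Lemma GK_kummer : z ^+ c = ev GK_disc.
Proof. by rewrite -(GK_degreeE n_ge2) exprM GK_z_pow exprMn GK_y_pow rmorphM rmorphXn. Qed.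

Lemma GK_disc_neq0 : GK_disc != 0.
Proof. by rewrite mulf_neq0 ?expf_neq0 ?(GK_W_neq0 n_ge2 n_pp cardF) ?(GK_h_neq0 n_ge2 n_pp cardF). Qed.

Lemma GK_c_gt0 : (0 < c)%N. Proof. by rewrite addn1. Qed.

Lemma GK_ev_h_neq0 : ev h != 0.
Proof. by rewrite ev_eq0 (GK_h_neq0 n_ge2 n_pp cardF). Qed.

Lemma GK_z_neq0 : z != 0.
Proof. exact: (kummer_gen_neq0 GK_ev_inj GK_c_gt0 GK_kummer GK_disc_neq0). Qed.

Lemma GK_yE : y = z ^+ A / ev h.
Proof. by rewrite GK_z_pow mulfK ?GK_ev_h_neq0. Qed.

Lemma GK_y_neq0 : y != 0.
Proof. by rewrite GK_yE mulf_neq0 ?expf_neq0 ?invr_eq0 ?GK_z_neq0 ?GK_ev_h_neq0. Qed.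

(** A subfield containing [x] and [z] contains [y] as well, by [GK_yE]. *)
Lemma GK_gen (S : {pred K}) : divring_closed S ->
  (forall k : F, iota k \in S) -> x \in S -> z \in S -> forall f : K, f \in S.
Proof.
move=> S_ring Siota Sx Sz; have [S1 SB SV] := S_ring; have [_ _ gen] := KGK.
have S0 : 0 \in S by rewrite -(subrr 1); exact: SB.
have SN f : f \in S -> - f \in S by move=> Sf; rewrite -sub0r; exact: SB.
have SD f g : f \in S -> g \in S -> f + g \in S.
  by move=> Sf Sg; rewrite -(opprK g); apply: (SB) => //; exact: SN.
have SM f g : f \in S -> g \in S -> f * g \in S.
  by move=> Sf Sg; rewrite -(invrK g); apply: (SV) => //; rewrite -div1r; exact: SV.
have SX f k : f \in S -> f ^+ k \in S.
  by move=> Sf; elim: k => [|k IH]; rewrite ?expr0 // exprS; exact: SM.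
have Sev P : ev P \in S.
  rewrite poly_evalE horner_coef; elim/big_ind: _ => // i _.
  by apply: (SM); rewrite ?coef_map ?Siota //; exact: SX.
by apply: gen => //; rewrite GK_yE; apply: (SV) => //; exact: SX.
Qed.

Lemma GK_place_over (M : {poly F}) : (1 < size M)%N ->
  exists Q, 0 <= Q x /\ 0 < Q (ev M).
Proof.
move=> sM; have alg := kummer_algebraic GK_ev_inj GK_c_gt0 GK_kummer GK_gen.
have [Q [Qev QM]] := exists_place_over GK_ev_inj (poly_evalC iota x) alg sM.
by exists Q; split=> //; rewrite -(poly_evalX iota x); exact: Qev.
Qed.

Lemma GK_y_value Q : Q y = A%:Z * Q z - Q (ev h).
Proof.
by rewrite GK_yE pvalM ?invr_eq0 ?expf_neq0 ?GK_z_neq0 ?GK_ev_h_neq0 // pvalV pvalX.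
Qed.

Lemma GK_degreeZ : A%:Z * n.+1%:Z = c%:Z /\ c%:Z = n%:Z ^+ 3 + 1.
Proof. by split; rewrite ?PoszD -?PoszM ?(GK_degreeE n_ge2) // -!rmorphXn /= -PoszD. Qed.

Section AtRoot.
Variable a : F.
Hypothesis a_root : root W a.

(** As [h * W] is separable, [a] is a simple root of [W] and no root of [h]. So [W] has the value of
    [x - iota a] and [h] has value 0; the rest follows from [GK_kummer] and [GK_yE]. *)
Lemma GK_root_values Q : 0 < Q (x - iota a) ->
  [/\ 0 < Q z, Q (x - iota a) = c%:Z * Q z & Q y = A%:Z * Q z].
Proof.
move=> Qa; have Qx := pval_root_nneg Qa.
have evXa : ev ('X - a%:P) = x - iota a by rewrite rmorphB /= poly_evalX poly_evalC.
have [R WE Ra] := GK_W_factor n_ge2 n_pp cardF a_root.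
have QR : Q (ev R) = 0.
  by apply: (pval_ev_coprime GK_ev_inj (N := 'X - a%:P)); rewrite ?coprimep_XsubC ?evXa.
have Qh : Q (ev h) = 0.
  apply: (pval_ev_coprime GK_ev_inj (N := 'X - a%:P)); rewrite ?evXa // coprimep_XsubC.
  by apply: (coprimep_root _ a_root); rewrite coprimep_sym GK_coprime.
have QW : Q (ev W) = Q (x - iota a).
  have R0 : R != 0 by apply: contraNneq Ra => ->; rewrite root0.
  by rewrite WE rmorphM pvalM ?ev_eq0 ?polyXsubC_eq0 // QR add0r -evXa.
have Qc : c%:Z * Q z = Q (x - iota a).
  rewrite -pvalX GK_kummer rmorphM rmorphXn /= pvalM ?expf_neq0 ?GK_ev_h_neq0 //.
    by rewrite QW pvalX Qh mulr0 addr0.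
  by rewrite ev_eq0 GK_W_neq0.
split=> //; last by rewrite GK_y_value Qh subr0.
by move: Qa; rewrite -Qc pmulr_rgt0 // ltz_nat GK_c_gt0.
Qed.

(** Divided by [Q z], the value of a term is [l + m c], which determines [l < c]. *)
Lemma GK_root_separates Q : 0 < Q (x - iota a) -> separates x z c Q.
Proof.
move=> Qa; have [z_pos xa_val _] := GK_root_values Qa.
move=> l l' P P' lt_l lt_l' P0 P'0.
have [m /(_ _ Qa) QP] := pval_ev_root GK_ev_inj a P0.
have [m' /(_ _ Qa) QP'] := pval_ev_root GK_ev_inj a P'0.
rewrite !pvalM ?expf_neq0 ?GK_z_neq0 ?ev_eq0 // !pvalX QP QP' xa_val => E.
apply: (congr_lt_eq (k := m%:Z - m'%:Z) lt_l lt_l').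
have z0 : Q z != 0 by rewrite gt_eqF.
apply: (mulIf z0); apply/eqP; rewrite -subr_eq0; apply/eqP.
transitivity ((l'%:Z * Q z + m'%:Z * (c%:Z * Q z)) - (l%:Z * Q z + m%:Z * (c%:Z * Q z))).
  by ring.
by rewrite E subrr.
Qed.

Lemma GK_root_unique Q Q' : 0 < Q (x - iota a) -> 0 < Q' (x - iota a) ->
  Q z = 1 /\ Q = Q'.
Proof.
move=> Qa Q'a; have [z_pos xa_val _] := GK_root_values Qa.
have [z_pos' xa_val' _] := GK_root_values Q'a.
apply: (separates_eq GK_ev_inj GK_c_gt0 GK_kummer GK_disc_neq0 GK_gen
  (GK_root_separates Qa) (GK_root_separates Q'a) z_pos z_pos').
move=> l P P0; have [m QP] := pval_ev_root GK_ev_inj a P0.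
exists (l%:Z + m%:Z * c%:Z).
rewrite !pvalM ?expf_neq0 ?GK_z_neq0 ?ev_eq0 // !pvalX !QP // xa_val xa_val'.
by split; ring.
Qed.

End AtRoot.

(** The degrees [n] of [W] and [n^2 - n] of [h] give [GK_disc] the degree [n^3 = c - 1], hence
    [c Q(z) = (c - 1) Q(x)]. The number [w] is the value of [z / x], which [GK_infty_unique] shows
    to be a uniformizer. *)
Lemma GK_infty_values Q (w := Q z - Q x) : Q x < 0 ->
  [/\ 0 < w, Q x = - (c%:Z * w), Q z = - (n%:Z ^+ 3 * w) & Q y = - (n%:Z * A%:Z * w)].
Proof.
move=> Qx; have [AE cE] := GK_degreeZ.
have n1 : n.+1%:Z = n%:Z + 1 by rewrite intS addrC.
have QW : Q (ev W) = n%:Z * Q x by rewrite (pval_ev_infty GK_ev_inj) ?GK_W_neq0 // GK_size_W.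
have Qh : Q (ev h) = (A%:Z - 1) * Q x.
  rewrite (pval_ev_infty GK_ev_inj) ?GK_h_neq0 // GK_size_h // addn1 /=.
  by rewrite intS; ring.
have Qz : c%:Z * Q z = (c%:Z - 1) * Q x.
  rewrite -pvalX GK_kummer rmorphM rmorphXn /= pvalM ?expf_neq0 ?GK_ev_h_neq0 //.
    by rewrite pvalX QW Qh -AE n1; ring.
  by rewrite ev_eq0 GK_W_neq0.
have QxE : Q x = - (c%:Z * w) by rewrite /w mulrBr Qz; ring.
have QzE : Q z = - (n%:Z ^+ 3 * w).
  have -> : Q z = w + Q x by rewrite /w subrK.
  by rewrite QxE cE; ring.
split=> //; first by move: Qx; rewrite QxE oppr_lt0 pmulr_rgt0 // ltz_nat GK_c_gt0.
rewrite GK_y_value Qh QzE QxE -AE n1.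
have -> : n%:Z ^+ 3 = A%:Z * (n%:Z + 1) - 1 by rewrite -n1 AE cE addrK.
ring.
Qed.

(** As [n^3] is -1 modulo [c], the value of a term divided by [w] is [l] modulo [c]. *)
Lemma GK_infty_separates Q : Q x < 0 -> separates x z c Q.
Proof.
move=> Qx l l' P P' lt_l lt_l' P0 P'0; have [_ cE] := GK_degreeZ.
have [w_pos x_val z_val _] := GK_infty_values Qx.
move: w_pos x_val z_val; set w := Q z - Q x => w_pos x_val z_val.
rewrite !pvalM ?expf_neq0 ?GK_z_neq0 ?ev_eq0 // !pvalX.
rewrite !(pval_ev_infty GK_ev_inj) // x_val z_val.
set d := Posz _.-1; set d' := Posz _.-1 => E.
apply: (congr_lt_eq (k := l'%:Z + d' - l%:Z - d) lt_l lt_l').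
have w0 : w != 0 by rewrite gt_eqF.
apply: (mulIf w0); apply/eqP; rewrite -subr_eq0; apply/eqP.
transitivity ((l'%:Z * - (n%:Z ^+ 3 * w) + d' * - (c%:Z * w))
    - (l%:Z * - (n%:Z ^+ 3 * w) + d * - (c%:Z * w))).
  by rewrite cE; ring.
by rewrite E subrr.
Qed.

Lemma GK_infty_unique Q Q' : Q x < 0 -> Q' x < 0 -> Q z - Q x = 1 /\ Q = Q'.
Proof.
move=> Qx Q'x; have [w_pos x_val z_val _] := GK_infty_values Qx.
have [w_pos' x_val' z_val' _] := GK_infty_values Q'x.
move: w_pos x_val z_val; set w := Q z - Q x => w_pos x_val z_val.
move: w_pos' x_val' z_val'; set w' := Q' z - Q' x => w_pos' x_val' z_val'.
apply: (separates_eq GK_ev_inj GK_c_gt0 GK_kummer GK_disc_neq0 GK_gen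
  (GK_infty_separates Qx) (GK_infty_separates Q'x) w_pos w_pos').
move=> l P P0; exists (- (l%:Z * n%:Z ^+ 3 + (size P).-1%:Z * c%:Z)).
rewrite !pvalM ?expf_neq0 ?GK_z_neq0 ?ev_eq0 // !pvalX !(pval_ev_infty GK_ev_inj) //.
by rewrite x_val z_val x_val' z_val'; split; ring.
Qed.

Lemma GK_nneg_values Q : 0 <= Q x -> 0 <= Q y /\ 0 <= Q z.
Proof.
move=> Qx; have Qy : 0 <= Q y.
  have := pval_ev_nneg W Qx; rewrite -GK_y_pow pvalX pmulr_rge0 //.
split=> //; have : 0 <= A%:Z * Q z.
  by rewrite -[A%:Z * Q z](subrK (Q (ev h))) -GK_y_value addr_ge0 // pval_ev_nneg.
by rewrite pmulr_rge0 // addn1.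
Qed.

Lemma GK_unramified_values (a : 'I_n -> F) Q :
    injective a -> (forall j, root W (a j)) -> 0 <= Q x ->
    (forall j, Q (x - iota (a j)) <= 0) ->
  Q y = 0 /\ A%:Z * Q z = Q (ev h).
Proof.
move=> a_inj a_root Qx Qa.
have evXa j : ev ('X - (a j)%:P) = x - iota (a j) by rewrite rmorphB /= poly_evalX poly_evalC.
have QW : Q (ev W) = 0.
  rewrite (GK_W_prod n_ge2 a_inj a_root) rmorph_prod pval_prod.
    rewrite big1 // => j _; apply/eqP; rewrite eq_le pval_ev_nneg // andbT.
    by have := Qa j; rewrite -evXa.
  by move=> j; rewrite ev_eq0 polyXsubC_eq0.
have Qy : Q y = 0.
  have : n.+1%:Z * Q y = 0 by rewrite -pvalX GK_y_pow.
  by move=> /eqP; rewrite mulf_eq0 => /orP [|/eqP].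
by split=> //; apply/eqP; rewrite -subr_eq0 -GK_y_value Qy.
Qed.

End GKPlaces.

(** * The subfield of rational functions in [x] *)

Section RationalFunctions.
Variables (F K : fieldType) (iota : {rmorphism F -> K}) (x : K).
Local Notation ev := (poly_eval iota x).
Hypothesis ev_inj : injective ev.

Definition in_Fx f := exists N M : {poly F}, [/\ N != 0, M != 0 & f = ev N / ev M].

Lemma in_Fx_ev N : N != 0 -> in_Fx (ev N).
Proof. by move=> N0; exists N, 1; rewrite oner_neq0 rmorph1 divr1. Qed.

Lemma in_FxM f g : in_Fx f -> in_Fx g -> in_Fx (f * g).
Proof.
move=> [N [M [N0 M0 ->]]] [N' [M' [N'0 M'0 ->]]].
by exists (N * N'), (M * M'); rewrite !mulf_neq0 // !rmorphM mulf_div.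
Qed.

Lemma in_FxV f : in_Fx f -> in_Fx f^-1.
Proof. by move=> [N [M [N0 M0 ->]]]; exists M, N; rewrite invf_div. Qed.

Lemma in_FxX f k : in_Fx f -> in_Fx (f ^+ k).
Proof.
by move=> [N [M [N0 M0 ->]]]; exists (N ^+ k), (M ^+ k); rewrite !expf_neq0 // !rmorphXn expr_div_n.
Qed.

Lemma in_FxXz f (k : int) : in_Fx f -> in_Fx (f ^ k).
Proof.
case: k => k Ff; first exact: in_FxX.
by rewrite NegzE -invr_expz; apply: in_FxV; exact: in_FxX.
Qed.

Lemma in_Fx_prod (I : Type) (r : seq I) (f : I -> K) :
  (forall i, in_Fx (f i)) -> in_Fx (\prod_(i <- r) f i).
Proof.
move=> Ff; elim/big_ind: _ => //; last exact: in_FxM.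
by rewrite -(rmorph1 ev); apply: in_Fx_ev; exact: oner_neq0.
Qed.

Lemma in_Fx_coprime f : in_Fx f ->
  exists N M : {poly F}, [/\ N != 0, M != 0, coprimep N M & f = ev N / ev M].
Proof.
move=> [N [M [N0 M0 ->]]]; set G := gcdp N M.
have G0 : G != 0 by rewrite gcdp_eq0 (negPf N0).
have NE : N = N %/ G * G by rewrite divpK // dvdp_gcdl.
have ME : M = M %/ G * G by rewrite divpK // dvdp_gcdr.
have N'0 : N %/ G != 0 by apply: contra_neq N0 => N'0; rewrite NE N'0 mul0r.
have M'0 : M %/ G != 0 by apply: contra_neq M0 => M'0; rewrite ME M'0 mul0r.
exists (N %/ G), (M %/ G); split=> //; first by rewrite coprimep_div_gcd ?N0.
rewrite {1}NE {1}ME !rmorphM -mulf_div divff ?mulr1 //.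
by rewrite (ev_eq0 ev_inj).
Qed.

End RationalFunctions.

(** With [A = n^2 - n + 1] and [c = (n + 1) A], both [n A = - A] and [n^3 = -1] hold modulo [c]. So
    the pole order at infinity determines [i A + k] modulo [c]; this number is below [c], and
    division by [A] recovers [i] and [k]. *)
Lemma pole_vector_index (n i k i' k' : nat) (X : int) : (2 <= n)%N ->
    (i <= n)%N -> (k < n ^ 2 - n + 1)%N -> (i' <= n)%N -> (k' < n ^ 2 - n + 1)%N ->
    (i%:Z * n%:Z * (n ^ 2 - n + 1)%N%:Z + k%:Z * n%:Z ^+ 3)
    - (i'%:Z * n%:Z * (n ^ 2 - n + 1)%N%:Z + k'%:Z * n%:Z ^+ 3) = (n ^ 3 + 1)%N%:Z * X ->
  i = i' /\ k = k'.
Proof.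
move=> n_ge2 le_i lt_k le_i' lt_k' E.
have [AE cE] := GK_degreeZ n_ge2; have AcE := GK_degreeE n_ge2.
set A := (n ^ 2 - n + 1)%N in lt_k lt_k' E AE AcE.
set c := (n ^ 3 + 1)%N in E AE cE AcE.
have A_gt0 : (0 < A)%N by rewrite /A addn1.
clearbody A c.
have lt_l j l : (j <= n)%N -> (l < A)%N -> (j * A + l < c)%N.
  move=> le_j lt_lA; rewrite -AcE mulnS addnC.
  by apply: leq_trans (_ : A + j * A <= _)%N; rewrite ?ltn_add2r // leq_add2l mulnC leq_mul2l le_j orbT.
have lE : (i * A + k)%N = (i' * A + k')%N.
  apply: (congr_lt_eq (k := X - (i%:Z - i'%:Z) - (k%:Z - k'%:Z)) (lt_l _ _ le_i lt_k)
    (lt_l _ _ le_i' lt_k')).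
  have n3 : n%:Z ^+ 3 = A%:Z * n.+1%:Z - 1 by rewrite AE cE addrK.
  by rewrite !PoszD !PoszM !mulrBr -E n3 -AE intS; ring.
have iE : i = i' by have := congr1 (divn^~ A) lE; rewrite /= !divnMDl // !divn_small // !addn0.
by split=> //; move: lE; rewrite iE => /addnI.
Qed.

(** * The Weierstrass semigroup and its minimal generators *)

Section GKSemigroup.
Variables (n : nat) (F : finFieldType).
Hypotheses (n_ge2 : (2 <= n)%N) (n_pp : prime_power n) (cardF : #|F| = (n ^ 6)%N).
Variables (K : fieldType) (iota : {rmorphism F -> K}) (x y z : K).
Hypothesis KGK : GK_function_field n iota x y z.
Variable a : 'I_n -> F.
Hypotheses (a_inj : injective a) (a_root : forall j, root ('X^n + 'X : {poly F}) (a j)).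
Variables (Pinf : place iota) (P : 'I_n -> place iota).
Hypotheses (Pinf_x : Pinf x < 0) (P_x : forall j, 0 < P j (x - iota (a j))).
Variables (m : nat) (m_le : (m <= n)%N).

Local Notation ev := (poly_eval iota x).
Local Notation A := (n ^ 2 - n + 1)%N.
Local Notation c := (n ^ 3 + 1)%N.
Local Notation h := (GK_h n 'X : {poly F}).
Local Notation wid := (widen_ord m_le).
Local Notation ev_inj := (GK_ev_inj KGK).
Local Notation ev_eq0 := (ev_eq0 ev_inj).
Local Notation y_neq0 := (GK_y_neq0 n_ge2 n_pp cardF KGK).
Local Notation z_neq0 := (GK_z_neq0 n_ge2 n_pp cardF KGK).
Implicit Types Q : place iota.

Lemma ev_XsubC b : ev ('X - b%:P) = x - iota b.
Proof. by rewrite rmorphB /= poly_evalX poly_evalC. Qed.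

Lemma x_sub_neq0 b : x - iota b != 0.
Proof. by rewrite -ev_XsubC ev_eq0 polyXsubC_eq0. Qed.

Lemma P_values j : [/\ P j z = 1, P j y = A%:Z & P j (x - iota (a j)) = c%:Z].
Proof.
have [_ xa_val y_val] := GK_root_values n_ge2 n_pp cardF KGK (a_root j) (P_x j).
have [z1 _] := GK_root_unique n_ge2 n_pp cardF KGK (a_root j) (P_x j) (P_x j).
by rewrite xa_val y_val z1 !mulr1.
Qed.

Lemma P_other i j : i != j -> P j (x - iota (a i)) = 0.
Proof.
move=> ij; rewrite -ev_XsubC.
apply: (pval_ev_coprime ev_inj (N := 'X - (a j)%:P)); last by rewrite ev_XsubC.
  exact: pval_root_nneg (P_x j).
by apply: coprimep_XsubC2; rewrite subr_eq0 (inj_eq a_inj) eq_sym.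
Qed.

Lemma Pinf_values : [/\ Pinf z = - (n%:Z ^+ 3), Pinf y = - (n%:Z * A%:Z) &
  forall b, Pinf (x - iota b) = - c%:Z].
Proof.
have [_ x_val z_val y_val] := GK_infty_values n_ge2 n_pp cardF KGK Pinf_x.
have [w1 _] := GK_infty_unique n_ge2 n_pp cardF KGK Pinf_x Pinf_x.
rewrite w1 !mulr1 in x_val z_val y_val; split=> // b.
by rewrite -ev_XsubC (pval_ev_infty ev_inj) ?polyXsubC_eq0 // size_XsubC mul1r.
Qed.

(** These are the places other than [Pinf] and the [m] chosen points, as [good_or_R] and
    [R_not_good] confirm; the inequalities refer only to values on [F[x]], so they are stable under
    conjugation. *)
Definition good Q := 0 <= Q x /\ forall s : 'I_m, Q (x - iota (a (wid s))) <= 0.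

Lemma good_sub Q s : good Q -> Q (x - iota (a (wid s))) = 0.
Proof.
by move=> [Qx /(_ s) Qs]; apply/eqP; rewrite eq_le Qs -ev_XsubC pval_ev_nneg.
Qed.

Lemma good_P j : (forall s, wid s != j) -> good (P j).
Proof.
move=> js; split; first exact: pval_root_nneg (P_x j).
by move=> s; rewrite P_other.
Qed.

Definition monomial (i k : nat) (e : 'I_m -> int) : K :=
  y ^+ i * z ^+ k * \prod_s (x - iota (a (wid s))) ^ (- e s).

Lemma monomial_neq0 i k e : monomial i k e != 0.
Proof.
rewrite !mulf_neq0 ?expf_neq0 ?y_neq0 ?z_neq0 //; apply/prodf_neq0 => s _.
by rewrite expfz_neq0 ?x_sub_neq0.
Qed.

Lemma pval_monomial Q i k e : Q (monomial i k e) =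
  i%:Z * Q y + k%:Z * Q z - \sum_s e s * Q (x - iota (a (wid s))).
Proof.
have prod0 : \prod_s (x - iota (a (wid s))) ^ (- e s) != 0.
  by apply/prodf_neq0 => s _; rewrite expfz_neq0 ?x_sub_neq0.
rewrite !pvalM ?mulf_neq0 ?expf_neq0 ?y_neq0 ?z_neq0 // !pvalX pval_prod; last first.
  by move=> s; rewrite expfz_neq0 ?x_sub_neq0.
by congr (_ + _); rewrite -sumrN; apply: eq_bigr => s _; rewrite pvalXz mulNr.
Qed.

Lemma P_monomial s i k e :
  P (wid s) (monomial i k e) = i%:Z * A%:Z + k%:Z - c%:Z * e s.
Proof.
have [z1 y_val xa_val] := P_values (wid s).
rewrite pval_monomial z1 y_val mulr1 (bigD1 s) //= xa_val big1 ?addr0 => [|t ts].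
  by ring.
by rewrite P_other ?mulr0 //; apply: contra ts => /eqP/(congr1 val)/= ts; apply/eqP/val_inj.
Qed.

Lemma Pinf_monomial i k e : Pinf (monomial i k e) =
  - (i%:Z * n%:Z * A%:Z + k%:Z * n%:Z ^+ 3 - c%:Z * \sum_s e s).
Proof.
have [z_val y_val xa_val] := Pinf_values.
rewrite pval_monomial z_val y_val; under eq_bigr do rewrite xa_val.
by rewrite -mulr_suml; ring.
Qed.

Lemma monomial_regular Q i k e : good Q -> 0 <= Q (monomial i k e).
Proof.
move=> gQ; have [Qx _] := gQ.
have [Qy Qz] := GK_nneg_values n_ge2 n_pp cardF KGK Qx.
rewrite pval_monomial big1 ?subr0 => [|s _]; first by rewrite addr_ge0 // mulr_ge0.
by rewrite good_sub // mulr0.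
Qed.

(* Dividing a regular term [z^l g(x)], [l = i A + k], by the monomial with the
   same values at [P_1, ..., P_m] leaves a rational function in [x] whose
   denominator has to be constant: at a place over a common factor of the
   denominator with [h], [z] has too small a value to compensate the pole, since
   [k < A] and [h] is separable. *)
Lemma regular_term (l : nat) (N0 M0 : {poly F}) (t := z ^+ l * ev N0 / ev M0) :
    (l < c)%N -> N0 != 0 -> M0 != 0 -> (forall Q, good Q -> 0 <= Q t) ->
  exists (i k : nat) (e : 'I_m -> int) (d : nat), [/\ (i <= n)%N, (k < A)%N,
    forall s, P (wid s) t = P (wid s) (monomial i k e) &
    Pinf t = Pinf (monomial i k e) - c%:Z * d%:Z].
Proof.
move=> lt_l N00 M00 t_reg.
have A_gt0 : (0 < A)%N by rewrite addn1.
have t0 : t != 0 by rewrite !mulf_neq0 ?expf_neq0 ?invr_eq0 ?z_neq0 ?ev_eq0.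
pose i := (l %/ A)%N; pose k := (l %% A)%N.
have lE : l = (i * A + k)%N by exact: divn_eq.
have le_i : (i <= n)%N by rewrite -ltnS ltn_divLR // mulnC GK_degreeE.
have lt_k : (k < A)%N by rewrite ltn_mod.
have P_t j : exists v : int, P j t = l%:Z - c%:Z * v.
  have [z1 _ xa_val] := P_values j.
  have [mN /(_ _ (P_x j)) QN] := pval_ev_root ev_inj (a j) N00.
  have [mM /(_ _ (P_x j)) QM] := pval_ev_root ev_inj (a j) M00.
  exists (mM%:Z - mN%:Z).
  rewrite /t !pvalM ?mulf_neq0 ?expf_neq0 ?invr_eq0 ?z_neq0 ?ev_eq0 //.
  by rewrite pvalV pvalX z1 QN QM xa_val; ring.
have /choice [v vP] := P_t.
pose e s := v (wid s).
have P_mon s : P (wid s) t = P (wid s) (monomial i k e).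
  by rewrite P_monomial vP {1}lE PoszD PoszM.
exists i, k, e.
pose g := t / monomial i k e.
have g0 : g != 0 by rewrite mulf_neq0 ?invr_eq0 ?monomial_neq0.
have g_val Q : Q g = Q t - Q (monomial i k e).
  by rewrite pvalM ?invr_eq0 ?monomial_neq0 // pvalV.
have Fx_g : in_Fx iota x g.
  have h0 := GK_ev_h_neq0 n_ge2 n_pp cardF KGK.
  have -> : g = ev N0 / ev M0 * ev h ^+ i * \prod_s (x - iota (a (wid s))) ^ (e s).
    rewrite /g /t /monomial (GK_yE n_ge2 n_pp cardF KGK) {1}lE mulnC exprD exprM.
    have -> : \prod_s (x - iota (a (wid s))) ^ (- e s) = (\prod_s (x - iota (a (wid s))) ^ (e s))^-1.
      by rewrite -prodfV; apply: eq_bigr => s _; rewrite invr_expz.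
    have : \prod_s (x - iota (a (wid s))) ^ (e s) != 0.
      by apply/prodf_neq0 => s _; rewrite expfz_neq0 ?x_sub_neq0.
    rewrite expr_div_n; set p := \prod_s _ => p0.
    by field_nz; rewrite ?ev_eq0 ?z_neq0.
  apply: in_FxM; last first.
    by apply: in_Fx_prod => s; apply: in_FxXz; rewrite -ev_XsubC; apply: in_Fx_ev; rewrite polyXsubC_eq0.
  apply: in_FxM; first by exists N0, M0.
  by apply: in_FxX; apply: in_Fx_ev; rewrite GK_h_neq0.
have [N [M [N_neq0 M_neq0 coNM gE]]] := in_Fx_coprime ev_inj Fx_g.
(* At a point that is not among the [m] chosen ones, [t] has value [l - c v], and [l < c];
   regularity forces [v <= 0], while [g] has value [- c v]. *)
have gP j : 0 <= P j g.
  have [[s js]|js] := pselect (exists s, wid s = j).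
    by rewrite g_val -js P_mon subrr.
  have gj : good (P j) by apply: good_P => s; apply/eqP => sj; apply: js; exists s.
  have [z1 y_val _] := P_values j.
  have tj := t_reg _ gj; rewrite vP in tj.
  have -> : P j g = - (c%:Z * v j).
    rewrite g_val vP pval_monomial y_val z1 big1 => [|s _]; last by rewrite good_sub // mulr0.
    by rewrite {1}lE PoszD PoszM; ring.
  have c_pos : 0 < c%:Z by rewrite ltz_nat GK_c_gt0.
  rewrite oppr_ge0 leNgt pmulr_rgt0 //; apply/negP => v_pos.
  have : c%:Z <= c%:Z * v j by rewrite ler_peMr.
  by move: tj lt_l; set C := c; set w := C%:Z * v j; lia.
have pole Q : 0 <= Q x -> 0 < Q (ev M) ->
    [/\ A%:Z * Q z = Q (ev h) & Q (ev M) <= k%:Z * Q z].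
  move=> Qx QM.
  have QN : Q (ev N) = 0 := pval_ev_coprime ev_inj Qx coNM QM.
  have Qg : Q g = - Q (ev M) by rewrite gE pval_div ?ev_eq0 // QN add0r.
  have notP j : Q (x - iota (a j)) <= 0.
    rewrite leNgt; apply/negP => Qj.
    have [_ QE] := GK_root_unique n_ge2 n_pp cardF KGK (a_root j) Qj (P_x j).
    by have := gP j; rewrite -QE Qg oppr_ge0 leNgt QM.
  have [Qy Qz] := GK_unramified_values n_ge2 n_pp cardF KGK a_inj a_root Qx notP.
  have gQ : good Q by split.
  split=> //; rewrite -subr_ge0.
  have -> : k%:Z * Q z - Q (ev M) = Q t.
    apply/eqP; rewrite -subr_eq0 addrAC -addrA -Qg g_val pval_monomial Qy.
    rewrite big1 => [|s _]; last by rewrite good_sub // mulr0.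
    by apply/eqP; ring.
  exact: t_reg.
(* If [z] had positive value, [k < A] would make [k Q(z)], a bound for the value of [M], smaller
   than [A Q(z)], the value of [h]. *)
have no_pole Q : 0 <= Q x -> 0 < Q (ev M) -> Q (ev h) <= Q (ev M) -> Q (ev h) = 0.
  move=> Qx QM le_hM; have [Qh QMz] := pole Q Qx QM.
  have [_ Qz] := GK_nneg_values n_ge2 n_pp cardF KGK Qx.
  apply/eqP; rewrite -Qh mulf_eq0 orbC; apply/orP; left.
  rewrite eq_le Qz andbT leNgt; apply/negP => z_pos.
  have : A%:Z * Q z <= k%:Z * Q z by rewrite Qh; exact: le_trans QMz.
  by rewrite ler_pM2r // lez_nat leqNgt lt_k.
have h_neq0 := GK_h_neq0 n_ge2 n_pp cardF.
have sM : size M = 1.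
  apply/eqP; rewrite eqn_leq size_poly_gt0 M_neq0 andbT leqNgt; apply/negP => sM.
  set G := gcdp M h.
  have ME : M = M %/ G * G by rewrite divpK // dvdp_gcdl.
  have hE : h = h %/ G * G by rewrite divpK // dvdp_gcdr.
  have M'0 : M %/ G != 0 by apply: contra_neq M_neq0 => M'0; rewrite ME M'0 mul0r.
  have h'0 : h %/ G != 0 by apply: contra_neq h_neq0 => h'0; rewrite hE h'0 mul0r.
  have G0 : G != 0 by rewrite gcdp_eq0 (negPf M_neq0).
  have [coMh|] := boolP (coprimep M h).
    have [Q [Qx QM]] := GK_place_over n_ge2 n_pp cardF KGK sM.
    have Qh : Q (ev h) = 0 by apply: (pval_ev_coprime ev_inj Qx _ QM); rewrite coprimep_sym.
    have [Az QMz] := pole Q Qx QM; rewrite Qh in Az.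
    move/eqP: Az; rewrite mulf_eq0 eqz_nat gtn_eqF //= => /eqP Qz.
    by move: QMz; rewrite Qz mulr0 leNgt QM.
  rewrite coprimep_def -/G => sG.
  have {}sG : (1 < size G)%N by rewrite ltn_neqAle eq_sym sG size_poly_gt0.
  have [Q [Qx QG]] := GK_place_over n_ge2 n_pp cardF KGK sG.
  have Qh' : Q (ev (h %/ G)) = 0.
    by apply: (pval_ev_coprime ev_inj Qx _ QG); exact: (GK_h_coprime n_ge2 n_pp cardF).
  have Qh : Q (ev h) = Q (ev G) by rewrite hE rmorphM pvalM ?ev_eq0 // Qh' add0r.
  have QM : Q (ev G) <= Q (ev M).
    by rewrite ME rmorphM pvalM ?ev_eq0 // lerDr pval_ev_nneg.
  have := no_pole Q Qx (lt_le_trans QG QM); rewrite Qh => /(_ QM) QG0.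
  by rewrite QG0 ltxx in QG.
(* The denominator is constant, so [g] is a polynomial in [x] and its pole order at infinity is [c]
   times its degree. *)
exists (size N).-1; split=> //.
have -> : Pinf t = Pinf g + Pinf (monomial i k e) by rewrite g_val subrK.
rewrite addrC gE pval_div ?ev_eq0 // !(pval_ev_infty ev_inj) // sM mul0r subr0.
have [_ _ /(_ 0)] := Pinf_values; rewrite rmorph0 subr0 => ->.
by ring.
Qed.

Local Notation R := (ord_cons Pinf (fun s : 'I_m => P (wid s))).

Lemma ord_cons0 (T : Type) (t : T) (f : 'I_m -> T) : ord_cons t f ord0 = t.
Proof. by rewrite /ord_cons unlift_none. Qed.

Lemma ord_consS (T : Type) (t : T) (f : 'I_m -> T) s : ord_cons t f (lift ord0 s) = f s.
Proof. by rewrite /ord_cons liftK. Qed.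

(* The pole orders of [x^d] times a monomial, negative at the zeros. *)
Definition pole_vector (i k : nat) (e : 'I_m -> int) (d : nat) : 'I_m.+1 -> int :=
  ord_cons (i%:Z * n%:Z * A%:Z + k%:Z * n%:Z ^+ 3 - c%:Z * \sum_s e s + c%:Z * d%:Z)
    (fun s => c%:Z * e s - i%:Z * A%:Z - k%:Z).

Lemma R_separates r : separates x z c (R r).
Proof.
case: (unliftP ord0 r) => [s ->|->]; rewrite ?ord_cons0 ?ord_consS.
  exact: (GK_root_separates n_ge2 n_pp cardF KGK (a_root (wid s)) (P_x _)).
exact: (GK_infty_separates n_ge2 n_pp cardF KGK Pinf_x).
Qed.

(** Among the components of [f], take the one of least value at [R r]. At the other chosen places
    its value is at least that of [f], which is a minimum over the components. It is regular
    elsewhere by [component_nneg], and [regular_term] gives its pole vector. *)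
Lemma regular_lub f r : f != 0 -> (forall Q, good Q -> 0 <= Q f) ->
  exists (i k : nat) (e : 'I_m -> int) (d : nat), [/\ (i <= n)%N, (k < A)%N,
    - R r f = pole_vector i k e d r & forall r', pole_vector i k e d r' <= - R r' f].
Proof.
move=> f0 f_reg.
have c_gt0 := GK_c_gt0 n.
have kummer := GK_kummer n_ge2 KGK.
have disc0 := GK_disc_neq0 n_ge2 n_pp cardF.
have gen := GK_gen n_ge2 n_pp cardF KGK.
have [B [M [M0 sB fE]]] := kummer_repr ev_inj c_gt0 kummer gen f.
have B0 : B != 0 by apply: contra_neq f0 => B0; rewrite fE B0 rmorph0 mul0r.
have [EB0 [l [lt_l Bl QB _]]] := separates_min ev_inj c_gt0 kummer disc0 (@R_separates r) B0 sB.
pose t := z ^+ l * ev B`_l / ev M.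
have term0 l' : B`_l' != 0 -> z ^+ l' * ev B`_l' != 0.
  by move=> ?; rewrite mulf_neq0 ?expf_neq0 ?z_neq0 ?ev_eq0.
have tl r' : R r' f <= R r' t.
  have [_ [l' [_ _ Q'B min_l']]] :=
    separates_min ev_inj c_gt0 kummer disc0 (@R_separates r') B0 sB.
  by rewrite fE !pval_div ?ev_eq0 ?term0 // Q'B lerD2r min_l'.
have rl : R r f = R r t by rewrite fE !pval_div ?ev_eq0 ?term0 // QB.
have t_reg Q : good Q -> 0 <= Q t.
  move=> gQ; have [xi xi_prim] := GK_primitive_root n_ge2 cardF.
  have c0 : (c%:R : F) != 0 by rewrite natrD natrX (natr_GK0 cardF) expr0n add0r oner_neq0.
  apply: (component_nneg ev_inj c_gt0 kummer disc0 gen (@R_separates r) xi_prim c0 (G := good));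
    rewrite -?fE //.
  move=> Q1 Q2 Q12 [Qx Qs]; split=> [|s]; first by rewrite -(poly_evalX iota x) Q12 poly_evalX.
  by rewrite -ev_XsubC Q12 ev_XsubC.
have [i [k [e [d [le_i lt_k Pt Pinf_t]]]]] := regular_term lt_l Bl M0 t_reg.
have R_t r' : - R r' t = pole_vector i k e d r'.
  rewrite /pole_vector; case: (unliftP ord0 r') => [s ->|->]; rewrite ?ord_cons0 ?ord_consS.
    by rewrite Pt P_monomial; ring.
  by rewrite Pinf_t Pinf_monomial; ring.
exists i, k, e, d; split=> // [|r']; first by rewrite rl R_t.
by rewrite -R_t lerN2.
Qed.

Lemma R_inj : injective R.
Proof.
have disj s : Pinf <> P (wid s).
  move=> E; have := pval_root_nneg (P_x (wid s)).
  by rewrite -E leNgt Pinf_x.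
move=> r r'; case: (unliftP ord0 r) => [s ->|->]; case: (unliftP ord0 r') => [s' ->|->];
  rewrite ?ord_cons0 ?ord_consS //; last 2 first.
- by move=> /esym/disj.
- by move=> /disj.
move=> E; congr lift; apply: contrapT => /eqP ss'.
by have := P_x (wid s); rewrite E P_other.
Qed.

Lemma good_or_R Q : good Q \/ exists r, R r = Q.
Proof.
have [Qx|Qx] := ltP (Q x) 0.
  right; exists ord0; rewrite ord_cons0.
  by have [_ ->] := GK_infty_unique n_ge2 n_pp cardF KGK Qx Pinf_x.
have [[s Qs]|Qs] := pselect (exists s : 'I_m, 0 < Q (x - iota (a (wid s)))).
  right; exists (lift ord0 s); rewrite ord_consS.
  by have [_ ->] := GK_root_unique n_ge2 n_pp cardF KGK (a_root (wid s)) Qs (P_x _).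
by left; split=> // s; rewrite leNgt; apply/negP => ?; apply: Qs; exists s.
Qed.

Lemma R_not_good r : ~ good (R r).
Proof.
case: (unliftP ord0 r) => [s ->|->]; rewrite ?ord_cons0 ?ord_consS => -[].
  by move=> _ /(_ s); rewrite leNgt P_x.
by rewrite leNgt Pinf_x.
Qed.

Lemma has_pole_divisorP f u : has_pole_divisor R f u <->
  (forall Q, good Q -> 0 <= Q f) /\ forall r, (u r)%:Z = Num.max 0 (- R r f).
Proof.
have pole_orderE Q : (pole_order f Q)%:Z = Num.max 0 (- Q f).
  by rewrite /pole_order gez0_abs // le_max lexx.
have sumR r : (\sum_(i < m.+1 | `[< R i = R r >]) u i = u r)%N.
  by rewrite (big_pred1 r) // => r'; apply/asboolP/eqP => [/R_inj|->].
split=> [fu|[f_reg fu] Q].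
  split=> [Q gQ|r]; last by rewrite -pole_orderE fu sumR.
  have := pole_orderE Q; rewrite fu big_pred0 => [|r]; last first.
    by apply/asboolP => QE; apply: (@R_not_good r); rewrite QE.
  by move=> /eqP; rewrite eq_sym; case: (leP 0 (- Q f)) => //; lia.
have [gQ|[r <-]] := good_or_R Q; last first.
  by apply/eqP; rewrite -eqz_nat pole_orderE sumR fu.
rewrite big_pred0 => [|r]; last first.
  by apply/asboolP => QE; apply: (@R_not_good r); rewrite QE.
apply/eqP; rewrite -eqz_nat pole_orderE; apply/eqP/max_idPl.
by rewrite oppr_le0 f_reg.
Qed.

(** A positive coordinate of [u] is not the result of truncation at 0, so it is the pole order
    itself. *)
Lemma Wsemigroup_lub u r : Wsemigroup R u -> (0 < u r)%N ->
  exists (i k : nat) (e : 'I_m -> int) (d : nat), [/\ (i <= n)%N, (k < A)%N,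
    pole_vector i k e d r = (u r)%:Z & forall r', pole_vector i k e d r' <= (u r')%:Z].
Proof.
move=> [f [f0 /has_pole_divisorP [f_reg fu]]] ur.
have [i [k [e [d [le_i lt_k vr v_le]]]]] := regular_lub r f0 f_reg.
exists i, k, e, d; split=> // [|r'].
  by rewrite -vr; move: ur; rewrite -ltz_nat fu; case: (leP 0 (- R r f)); rewrite ?ltxx.
by rewrite fu le_max v_le orbT.
Qed.

Lemma Wsemigroup_monomial (i k : nat) e :
  Wsemigroup R (fun r => absz (Num.max 0 (pole_vector i k e 0 r))).
Proof.
exists (monomial i k e); split; first exact: monomial_neq0.
apply/has_pole_divisorP; split=> [Q|r]; first exact: monomial_regular.
rewrite gez0_abs ?le_max ?lexx //; congr Num.max; rewrite /pole_vector.
case: (unliftP ord0 r) => [s ->|->]; rewrite ?ord_cons0 ?ord_consS.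
  by rewrite P_monomial; ring.
by rewrite Pinf_monomial; ring.
Qed.

Lemma min_gen_set_monomial u : (0 < m)%N -> min_gen_set R u ->
  exists (i k : nat) (e : 'I_m -> int), [/\ (i <= n)%N, (k < A)%N &
    forall r, (u r)%:Z = pole_vector i k e 0 r].
Proof.
move=> m_gt0 [u_pos [r [[Hu _] u_min]]].
have [i [k [e [d [le_i lt_k vr v_le]]]]] := Wsemigroup_lub Hu (u_pos r).
(* Only [d] has to be removed. The truncation of the vector with [d = 0] is then a semigroup element
   below [u] with the same coordinate at [r], so it equals [u] by minimality; positivity of [u]
   undoes the truncation. *)
suff [e' [vr' v_le']] : exists e' : 'I_m -> int, pole_vector i k e' 0 r = (u r)%:Z /\
    forall r', pole_vector i k e' 0 r' <= (u r')%:Z.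
  pose p r' := absz (Num.max 0 (pole_vector i k e' 0 r')).
  have pE r' : (p r')%:Z = Num.max 0 (pole_vector i k e' 0 r').
    by rewrite gez0_abs // le_max lexx.
  have pu : p = u.
    apply: u_min => [|r']; last by rewrite -lez_nat pE ge_max v_le' andbT.
    split; first exact: Wsemigroup_monomial.
    by apply/eqP; rewrite -eqz_nat pE vr'; apply/eqP/max_idPr.
  exists i, k, e'; split=> // r'; have := u_pos r'.
  by rewrite -ltz_nat -pu pE; case: (leP 0 (pole_vector i k e' 0 r')); rewrite ?ltxx.
move: vr v_le; rewrite /pole_vector; case: (unliftP ord0 r) => [s ->|->] vr v_le.
  (* At a finite point, dropping [d] only lowers the coordinate at infinity. *)
  exists e; split=> [|r']; first by move: vr; rewrite !ord_consS.
  have := v_le r'; case: (unliftP ord0 r') => [s' ->|->]; rewrite ?ord_cons0 ?ord_consS //.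
  by apply: le_trans; rewrite mulr0 addr0 lerDl mulr_ge0.
(* At infinity, [d] is absorbed into one exponent: the coordinate at infinity stays the same and the
   one at [s0] can only decrease. *)
pose s0 := Ordinal m_gt0; exists (fun s => if s == s0 then e s - d%:Z else e s).
have sumE : \sum_s (if s == s0 then e s - d%:Z else e s) = \sum_s e s - d%:Z.
  rewrite (bigD1 s0) //= ?eqxx [in RHS](bigD1 s0) //= addrAC; congr (_ + _ - _).
  by apply: eq_bigr => s /negPf ->.
split=> [|r'].
  by move: vr; rewrite !ord_cons0 sumE => <-; ring.
have := v_le r'; case: (unliftP ord0 r') => [s' ->|->]; rewrite ?ord_cons0 ?ord_consS.
  apply: le_trans; rewrite !lerD2r ler_wpM2l //; case: eqP => // _.
  by rewrite gerBl.
by rewrite sumE; apply: le_trans; rewrite le_eqVlt; apply/orP; left; apply/eqP; ring.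
Qed.

(** Minimality holds with the coordinate at infinity fixed. For a smaller [p], a vector below [p]
    attains this coordinate, and [pole_vector_index] gives it the same [i] and [k]. Then [e' <= e]
    termwise while the sum of [e'] is that of [e] plus [d], so [e' = e], and [p] is also at least
    [u]. *)
Lemma monomial_min_gen_set u (i k : nat) (e : 'I_m -> int) :
  (i <= n)%N -> (k < A)%N -> (forall r, (0 < u r)%N) ->
  (forall r, (u r)%:Z = pole_vector i k e 0 r) -> min_gen_set R u.
Proof.
move=> le_i lt_k u_pos uE; split=> //; exists ord0; split.
  split=> //; have := Wsemigroup_monomial i k e; congr (Wsemigroup R _).
  apply/funext => r; rewrite -uE; apply/eqP; rewrite -eqz_nat gez0_abs ?le_max ?lexx //.
  by apply/eqP/max_idPr.
move=> p [Hp p0] le_pu; have p0_pos : (0 < p ord0)%N by rewrite p0.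
have [i' [k' [e' [d [le_i' lt_k' v0 v_le]]]]] := Wsemigroup_lub Hp p0_pos.
have v0E : pole_vector i' k' e' d ord0 = pole_vector i k e 0 ord0 by rewrite v0 p0 uE.
move: (v0E); rewrite /pole_vector !ord_cons0 => E.
have [iE kE] : i' = i /\ k' = k.
  apply: (@pole_vector_index n i' k' i k (\sum_s e' s - \sum_s e s - d%:Z)) => //.
  apply/eqP; rewrite -subr_eq0; move/eqP: E; rewrite -subr_eq0 => /eqP E.
  by apply/eqP; apply: (etrans _ E); ring.
subst i' k'.
have c_gt0 : 0 < c%:Z by rewrite ltz_nat GK_c_gt0.
have vS s : c%:Z * e' s <= (p (lift ord0 s))%:Z + i%:Z * A%:Z + k%:Z.
  by have := v_le (lift ord0 s); rewrite /pole_vector ord_consS !lerBlDr addrAC.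
have uS s : (u (lift ord0 s))%:Z + i%:Z * A%:Z + k%:Z = c%:Z * e s.
  by rewrite uE /pole_vector ord_consS; ring.
have le_e s : e' s <= e s.
  rewrite -(ler_pM2l c_gt0); apply: le_trans (vS s) _.
  by rewrite -uS !lerD2r lez_nat le_pu.
have sumE : \sum_s e' s - d%:Z = \sum_s e s.
  have c0 : c%:Z != 0 by rewrite gt_eqF.
  apply: (mulfI c0); apply/eqP; rewrite -subr_eq0; move/eqP: E; rewrite -subr_eq0 => /eqP E.
  by move/(congr1 -%R): E; rewrite oppr0 => E; apply/eqP; apply: (etrans _ E); ring.
have eE s : e' s = e s.
  have : \sum_s (e s - e' s) <= 0 by rewrite sumrB -sumE addrAC subrr add0r oppr_le0.
  rewrite (bigD1 s) //= => le0; apply: le_anti; rewrite le_e -subr_le0.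
  apply: le_trans le0; rewrite lerDl; apply: sumr_ge0 => t _.
  by rewrite subr_ge0.
apply/funext => r; case: (unliftP ord0 r) => [s ->|-> //].
apply/eqP; rewrite eqn_leq le_pu -lez_nat -(lerD2r (i%:Z * A%:Z)) -(lerD2r k%:Z).
by rewrite uS -eE vS.
Qed.

End GKSemigroup.

(** * From the center of a place to the value of [x] *)

Section Centers.
Variables (F K : fieldType) (iota : {rmorphism F -> K}) (x y z : K).
Implicit Types Q : place iota.

Lemma vanishes_coord Q (p : 'rV[F]_4) : centered_at x y z Q p ->
  exists lam, [/\ lam != 0, vanishes_at Q (lam * x - iota (p 0 0)) &
    vanishes_at Q (lam - iota (p 0 (lift ord0 (lift ord0 (lift ord0 ord0)))))].
Proof.
move=> [lam [lam0 H]]; exists lam; split=> //; first exact: (H ord0).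
by have := H (lift ord0 (lift ord0 (lift ord0 ord0))); rewrite /= mulr1.
Qed.

Lemma vanishes_unit Q f k : k != 0 -> vanishes_at Q (f - iota k) -> f != 0 /\ Q f = 0.
Proof.
move=> k0 fk; have ik0 : iota k != 0 by rewrite fmorph_eq0.
have [||] := @pvalD_lt _ _ _ Q (iota k) (f - iota k) => //.
  by case: fk => [->|fk]; [left | right; rewrite pvalC // add0r -gtz0_ge1].
by rewrite addrC subrK pvalC.
Qed.

(** The factor [lam] has positive value, whereas [lam * x] reduces to 1 and has value 0. *)
Lemma center_infty Q : centered_at x y z Q (hpoint 1 0 0 0) -> Q x < 0.
Proof.
move=> /vanishes_coord [lam [lam0]]; rewrite !mxE /= rmorph0 subr0.
move=> /(vanishes_unit (oner_neq0 _)) [lx0 Qlx] [/eqP|Qlam]; first by rewrite (negPf lam0).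
have x0 : x != 0 by apply: contra_neq lx0 => ->; rewrite mulr0.
by move: Qlx; rewrite pvalM // => /eqP; rewrite addr_eq0 => /eqP E; move: Qlam; rewrite E oppr_gt0.
Qed.

(** Here [lam] reduces to 1, so it is a unit at [Q], and [lam (x - a) = (lam x - a) - a (lam - 1)]
    vanishes there. *)
Lemma center_finite Q a : x - iota a != 0 ->
  centered_at x y z Q (hpoint a 0 0 1) -> 0 < Q (x - iota a).
Proof.
move=> xa0 /vanishes_coord [lam [lam0]]; rewrite !mxE /= => lx l1.
have [_ Qlam] := vanishes_unit (oner_neq0 _) l1.
suff : vge Q 1 (lam * (x - iota a)).
  move=> [/eqP|]; first by rewrite mulf_eq0 (negPf lam0) (negPf xa0).
  by rewrite pvalM // Qlam add0r.
have -> : lam * (x - iota a) = (lam * x - iota a) + - iota a * (lam - iota 1).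
  by rewrite rmorph1; ring.
apply: vgeD; first by case: lx => [->|]; [left | right].
case: l1 => [->|Ql1]; first by left; rewrite mulr0.
have [->|a0] := eqVneq a 0; first by left; rewrite rmorph0 oppr0 mul0r.
have l10 : lam - iota 1 != 0 by apply: contraTneq Ql1 => ->; rewrite pval0 ltxx.
by right; rewrite pvalM ?oppr_eq0 ?fmorph_eq0 // pvalN pvalC // add0r.
Qed.

End Centers.


(** * Translation between pole vectors and the tuples of [GK_Gamma] *)

Theorem theorem3p4 (n : nat) (n_ge2 : (2 <= n)%N) (n_pp : prime_power n)
    (F : finFieldType) (cardF : #|F| = (n ^ 6)%N)
    (K : fieldType) (iota : {rmorphism F -> K}) (x y z : K)
    (KGK : GK_function_field n iota x y z)
    (a : 'I_n -> F) (a_inj : injective a)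
    (a_root : forall j, a j ^+ n + a j = 0)
    (Pinf : place iota) (P : 'I_n -> place iota)
    (Pinf_center : centered_at x y z Pinf (hpoint 1 0 0 0))
    (P_center : forall j, centered_at x y z (P j) (hpoint (a j) 0 0 1))
    (m : nat) (m_ge1 : (1 <= m)%N) (m_le : (m <= n)%N) :
  min_gen_set (ord_cons Pinf (fun s : 'I_m => P (widen_ord m_le s)))
    = GK_Gamma n m.
Proof.
have Pinf_x := center_infty Pinf_center.
have P_x j : 0 < P j (x - iota (a j)).
  by apply: center_finite (P_center j); apply: x_sub_neq0 KGK _.
have W_root j : root ('X^n + 'X : {poly F}) (a j).
  by rewrite /root !hornerE a_root.
have [AcE cE] := GK_degreeZ n_ge2.
have AE : (n ^ 2 - n + 1)%N%:Z = n%:Z ^+ 2 - n%:Z + 1.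
  have le_n : (n <= n ^ 2)%N by rewrite expnS leq_pmulr // ltnW.
  by rewrite PoszD -subzn // -rmorphXn.
have c_gt0 : 0 < (n ^ 3 + 1)%N%:Z by rewrite ltz_nat addn1.
have A_nS : n.+1%:Z = n%:Z + 1 by rewrite intS addrC.
have sum1 (f : 'I_m -> int) : \sum_s (f s + 1) = \sum_s f s + m%:Z.
  by rewrite big_split /= sumr_const card_ord natz.
apply/seteqP; split=> u.
  move=> u_gen; have [u_pos _] := u_gen.
  have [i [k [e [le_i lt_k uE]]]] :=
    min_gen_set_monomial n_ge2 n_pp cardF KGK a_inj W_root Pinf_x P_x m_ge1 u_gen.
  have u0E := uE ord0; have uSE s := uE (lift ord0 s).
  rewrite /pole_vector ord_cons0 AE cE mulr0 addr0 in u0E.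
  have sum_e : \sum_s (e s - 1) = \sum_s e s - m%:Z.
    by rewrite -(addrK m%:Z (\sum_s (e s - 1))) -sum1; under eq_bigr do rewrite subrK.
  (* Since [c = n A + A], one has [c e - i A - k = (e - 1) c + (n - i) A + (A - k)], which dictates
     the new indices. *)
  exists ((n ^ 2 - n + 1)%N%:Z - k%:Z), (n%:Z - i%:Z), (fun s => e s - 1).
  have u0E' : (u ord0)%:Z = (n%:Z ^+ 2 - m%:Z - \sum_s (e s - 1)) * (n%:Z ^+ 3 + 1)
      - (n%:Z - i%:Z) * n%:Z * (n%:Z ^+ 2 - n%:Z + 1)
      - ((n ^ 2 - n + 1)%N%:Z - k%:Z) * n%:Z ^+ 3.
    by rewrite u0E sum_e AE; ring.
  split.
  - by rewrite -AE gerBl andbT lerBrDr -PoszD lez_nat add1n.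
  - by rewrite subr_ge0 gerBl lez_nat le_i.
  (* The pole order [c e - i A - k] is positive, so [c e] is positive. *)
  - move=> s; suff : 0 < e s by lia.
    rewrite -(pmulr_rgt0 _ c_gt0).
    have := uSE s; rewrite /pole_vector ord_consS => /esym/eqP; rewrite !subr_eq => /eqP ->.
    have : 0 <= i%:Z * (n ^ 2 - n + 1)%N%:Z by rewrite mulr_ge0.
    by have := u_pos (lift ord0 s); lia.
  - by rewrite -u0E' ltz_nat u_pos.
  split=> // s; rewrite uSE /pole_vector ord_consS cE AE; ring.
move=> [k [i [j [/andP [k_ge1 k_le] /andP [i_ge0 i_le] j_ge0 u0_pos [u0E uSE]]]]].
rewrite -AE in k_le u0E uSE.
(* The same substitution read backwards; the ranges of [i] and [k] make both differences
   nonnegative, so [absz] does not change them. *)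
pose i' := absz (n%:Z - i); pose k' := absz ((n ^ 2 - n + 1)%N%:Z - k).
have i'E : i'%:Z = n%:Z - i by rewrite gez0_abs // subr_ge0.
have k'E : k'%:Z = (n ^ 2 - n + 1)%N%:Z - k by rewrite gez0_abs // subr_ge0.
apply: (monomial_min_gen_set n_ge2 n_pp cardF KGK a_inj W_root Pinf_x P_x m_le
  (i := i') (k := k') (e := fun s => j s + 1)).
- by rewrite -lez_nat i'E gerBl.
- by rewrite -ltz_nat k'E gtrBl; lia.
- move=> r; rewrite -ltz_nat; case: (unliftP ord0 r) => [s ->|->].
    have : 0 <= j s * (n%:Z ^+ 3 + 1) by rewrite mulr_ge0 // -cE ltW.
    have : 0 <= i * (n ^ 2 - n + 1)%N%:Z by rewrite mulr_ge0.
    by rewrite uSE; lia.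
  by rewrite u0E AE.
move=> r; rewrite /pole_vector.
case: (unliftP ord0 r) => [s ->|->]; rewrite ?ord_cons0 ?ord_consS i'E k'E cE.
  by rewrite uSE AE; ring.
by rewrite u0E sum1 AE; ring.
Qed.
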